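(* Let $A$ be a Banach algebra and let $n\ge0$ be an integer. (i) Suppose that the topology on $\mathscr H^{n+1}(A,X)$ is trivial for each Banach $A$-bimodule $X$. Then $\operatorname{db}A\le n$. (ii) Suppose that the topology on $\mathscr H^{n+1}(A,X^* )$ is trivial for each Banach $A$-bimodule $X$. Then $\operatorname{w.db}A\le n$.
   Context: Banach algebras are not assumed unital. A Banach $A$-bimodule is a Banach space with commuting jointly continuous associative left and right actions of $A$; the dual $X^*$ of a Banach $A$-bimodule is a Banach $A$-bimodule via $(a\cdot f)(x)=f(x\cdot a)$, $(f\cdot a)(x)=f(a\cdot x)$. $\mathscr H^n(A,X)$ is the $n$th continuous Hochschild cohomology group of $A$ with coefficients in $X$ (cohomology of the standard complex of continuous $n$-linear maps $A\times\cdots\times A\to X$ with the Hochschild coboundary), with the quotient seminorm (cocycles modulo coboundaries). The topology of a seminormed cohomology space is trivial if it is indiscrete, i.e. the coboundaries are dense in the cocycles. $A_+$ is the unitization of $A$ and $A^e=A_+\mathbin{\widehat\otimes}A_+^{\mathrm{op}}$ is the enveloping algebra ($\widehat\otimes$ is the completed projective tensor product). Banach $A$-bimodules are the same as unital left Banach $A^e$-modules via $(a\otimes b)\cdot x=a\cdot x\cdot b$. For a Banach algebra $B$ and left Banach $B$-modules $X,Y$, $\operatorname{Ext}^n_B(X,Y)$ is the $n$th cohomology of the complex of bounded $B$-module maps $P_\bullet\to Y$, where $P_\bullet$ is a projective resolution of $X$: a complex of projective modules with a morphism $P_0\to X$ such that $P_\bullet\to X\to0$ splits as a complex of Banach spaces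 (projective means that module maps lift along surjective bounded module maps that have a bounded linear right inverse). There is a topological isomorphism $\operatorname{Ext}^n_{A^e}(A_+,X)\cong\mathscr H^n(A,X)$ for each Banach $A$-bimodule $X$. The projective homological dimension $\operatorname{dh}_BX$ is the least integer $n\ge0$ with $\operatorname{Ext}^{n+1}_B(X,Y)=0$ for each left Banach $B$-module $Y$; the weak homological dimension $\operatorname{w.dh}_BX$ is the least integer $n\ge0$ with $\operatorname{Ext}^{n+1}_B(X,Y^* )=0$ for each right Banach $B$-module $Y$. The homological bidimension and the weak homological bidimension of $A$ are $\operatorname{db}A=\operatorname{dh}_{A^e}A_+$ and $\operatorname{w.db}A=\operatorname{w.dh}_{A^e}A_+$. *)

(* Defs.v *)
From HB Require Import structures.
From mathcomp Require Import all_boot all_order all_algebra complex sesquilinear.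
From mathcomp Require Import all_classical all_reals ereal topology normedtype.
From mathcomp Require Import derive.

Set Implicit Arguments.
Unset Strict Implicit.
Unset Printing Implicit Defensive.

Import Order.TTheory GRing.Theory Num.Theory numFieldNormedType.Exports.
Local Open Scope classical_set_scope.
Local Open Scope ring_scope.

(* The scalar field is the field R[i] of complex numbers; norms take their
   values in the nonnegative real elements of R[i]. *)

Section BoundedMaps.
Context {R : realType}.
Local Notation C := R[i].
Implicit Types U V W : normedModType C.

Definition bounded_linear U V (f : U -> V) : Prop := linear f /\ continuous f.

Definition bilinear_map U V W (f : U -> V -> W) : Prop :=
  (forall v, linear (f^~ v)) /\ (forall u, linear (f u)).

Definition bounded_bilinear U V W (f : U -> V -> W) : Prop :=
  bilinear_map f /\ continuous (fun p : U * V => f p.1 p.2).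

Definition linear_pack U V (f : U -> V) (lf : linear f) : {linear U -> V} :=
  HB.pack f (GRing.isLinear.Build C U V *:%R f lf).

Lemma bounded_linearP U V (f : U -> V) : linear f ->
  continuous f <-> exists c, 0 <= c /\ forall x, `|f x| <= c * `|x|.
Proof.
move=> lf; rewrite -[f]/(linear_pack lf : U -> V).
rewrite -linear_bounded_continuous linear_boundedP; split.
  by move=> /pinfty_ex_gt0[c c0 fc]; exists c; split => //; exact: ltW.
move=> [c [c0 fc]]; exists c; split; first exact: ger0_real.
by move=> r cr x; rewrite (le_trans (fc x))// ler_wpM2r// ltW.
Qed.

Lemma bounded_bilinearP U V W (f : U -> V -> W) : bilinear_map f ->
  continuous (fun p : U * V => f p.1 p.2) <->
  exists c, 0 <= c /\ forall u v, `|f u v| <= c * `|u| * `|v|.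
Proof.
move=> [lf rf]; split=> [cf|[c [c0 fc]]].
  have bf : bilinear_for *:%R *:%R f by split.
  pose F : {bilinear U -> V -> W} :=
    HB.pack f (bilinear_isBilinear.Build C U V W *:%R *:%R f bf).
  have [k k0 fk] := @bilinear_schwarz _ _ _ _ F cf.
  by exists k; split; [exact: ltW|exact: fk].
move=> [u v]; pose F (p : U * V) : C^o :=
  c * (`|p.1 - u| * `|p.2|) + c * (`|u| * `|p.2 - v|).
have F0 : F @ (u, v) --> (0 : C^o).
  have -> : 0 = c * (`|u - u| * `|v|) + c * (`|u| * `|v - v|) :> C^o.
    by rewrite !subrr !normr0 mul0r !mulr0 addr0.
  have p1 : (fun p : U * V => p.1) @ (u, v) --> u by exact: cvg_fst.
  have p2 : (fun p : U * V => p.2) @ (u, v) --> v by exact: cvg_snd.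
  apply: (@cvgD _ C^o); apply: (@cvgM C _ _ _ (cst c)); try exact: cvg_cst.
    apply: cvgM; last exact: (cvg_norm p2).
    by apply: cvg_norm; apply: cvgB => //; exact: cvg_cst.
  apply: cvgM; first exact: cvg_cst.
  by apply: cvg_norm; apply: cvgB => //; exact: cvg_cst.
apply/cvgrPdistC_lt => /= e e0; near=> p.
have lB x y z : f (x - y) z = f x z - f y z.
  by rewrite -scaleN1r addrC lf scaleN1r addrC.
have rB x y z : f x (y - z) = f x y - f x z.
  by rewrite -scaleN1r addrC rf scaleN1r addrC.
have -> : f p.1 p.2 - f u v = f (p.1 - u) p.2 + f u (p.2 - v).
  by rewrite lB rB addrA subrK.
rewrite (le_lt_trans (ler_normD _ _))//.
rewrite (@le_lt_trans _ _ (F p))//.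
  by rewrite /F !mulrA lerD.
have Fp0 : 0 <= F p by rewrite addr_ge0// !mulr_ge0.
rewrite -(ger0_norm Fp0); near: p.
exact: (cvgr0_norm_lt _ F0 _ e0).
Unshelve. all: by end_near. Qed.

End BoundedMaps.

Local Notation Re := complex.Re.
Local Notation Im := complex.Im.

Section ComplexComplete.
Variable R : realType.
Local Notation C := R[i].
Local Open Scope complex_scope.

HB.instance Definition _ := PseudoPointedMetric.copy C C^o.
HB.instance Definition _ := NormedModule.copy C C^o.

Lemma normc_real (x : R) : `|x%:C| = `|x|%:C.
Proof. by rewrite normc_def /= expr0n addr0 sqrtr_sqr. Qed.

Lemma normc_ge_Im (z : C) : `|Im z|%:C <= `|z|.
Proof.
case: z => a b; rewrite normc_def lecR /= -sqrtr_sqr.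
by rewrite ler_wsqrtr // lerDr sqr_ge0.
Qed.

Lemma normc_le_ReIm (z : C) : `|z| <= (`|Re z| + `|Im z|)%:C.
Proof.
rewrite {1}[z]complexE (le_trans (ler_normD _ _))// normrM rmorphD/=.
rewrite !normc_real lerD2l normc_def /= expr0n expr1n add0r sqrtr1.
by rewrite mul1r.
Qed.

Lemma complex_cauchy_cvg (F : set_system C) :
  ProperFilter F -> cauchy F -> cvg F.
Proof.
move=> FF /cauchy_ballP Fc.
have sub (g : C -> R) : (forall x y, g (x - y) = g x - g y) ->
    (forall z, `|g z|%:C <= `|z|) -> cvg (g @ F).
  move=> gB gn; apply/cauchy_cvgP/cauchy_ballP => e e0; rewrite near_map2.
  have e0' : 0 < e%:C :> C by rewrite ltcR.
  apply: filterS (Fc _ e0') => -[x y] /=; rewrite -!ball_normE /= => xy.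
  by rewrite -gB -ltcR (le_lt_trans (gn _)).
have /cvg_ex[/= a Fa] := sub (@Re R)
  ltac:(by move=> [? ?] [? ?]) (@normc_ge_Re R).
have /cvg_ex[/= b Fb] := sub (@Im R)
  ltac:(by move=> [? ?] [? ?]) normc_ge_Im.
apply/cvg_ex; exists (a +i* b); apply/cvgrPdist_lt => /= e e0.
have [eR eI] : 0 < Re e /\ e = (Re e)%:C.
  case: e e0 => x y; rewrite ltcE /= => /andP[/eqP-> x0].
  by split.
near=> z; rewrite (le_lt_trans (normc_le_ReIm _))// eI ltcR.
rewrite [ltRHS]splitr; apply: ltrD.
  have -> : Re (a +i* b - z) = a - Re z by case: (z).
  by near: z; apply: (cvgr_dist_lt _ _ Fa); rewrite divr_gt0.
have -> : Im (a +i* b - z) = b - Im z by case: (z).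
by near: z; apply: (cvgr_dist_lt _ _ Fb); rewrite divr_gt0.
Unshelve. all: by end_near. Qed.

HB.instance Definition _ := Uniform_isComplete.Build C complex_cauchy_cvg.

End ComplexComplete.
Section BanachAlgebra.
Variable R : realType.
Local Notation C := R[i].

Record banachAlgebra := BanachAlgebra {
  ba_space :> completeNormedModType C;
  ba_mul : ba_space -> ba_space -> ba_space;
  ba_mulA : associative ba_mul;
  ba_mul_bilinear : bilinear_map ba_mul;
  ba_norm_mul : forall a b, `|ba_mul a b| <= `|a| * `|b| }.

Lemma ba_mulPl (A : banachAlgebra) (k : C) (a b c : A) :
  ba_mul (k *: a + b) c = k *: ba_mul a c + ba_mul b c.
Proof. exact: (ba_mul_bilinear A).1. Qed.

Lemma ba_mulPr (A : banachAlgebra) (k : C) (a b c : A) :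
  ba_mul c (k *: a + b) = k *: ba_mul c a + ba_mul c b.
Proof. exact: (ba_mul_bilinear A).2. Qed.

End BanachAlgebra.
Arguments ba_mul {R A} : rename.

Section Unitization.
Context {R : realType}.
Local Notation C := R[i].

(* The underlying space of A_+; the product type A * C itself carries the
   max norm, which is not submultiplicative for the unitization product. *)
Definition unitz (A : banachAlgebra R) : Type := (A * C)%type.

Variable A : banachAlgebra R.

HB.instance Definition _ := GRing.Lmodule.copy (unitz A) (A * C)%type.

Definition unitz_norm (x : unitz A) : C := `|x.1| + `|x.2|.

Lemma unitz_normD x y : unitz_norm (x + y) <= unitz_norm x + unitz_norm y.
Proof. by rewrite /unitz_norm addrACA lerD// ler_normD. Qed.

Lemma unitz_normZ (l : C) x : unitz_norm (l *: x) = `|l| * unitz_norm x.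
Proof. by rewrite /unitz_norm mulrDr !normrZ. Qed.

Lemma unitz_norm_eq0 x : unitz_norm x = 0 -> x = 0.
Proof.
case: x => a l /eqP; rewrite /unitz_norm paddr_eq0//= !normr_eq0.
by move=> /andP[/eqP-> /eqP->].
Qed.

HB.instance Definition _ :=
  Lmodule_isNormed.Build C (unitz A) unitz_normD unitz_normZ unitz_norm_eq0.

Lemma unitz_normE (x : unitz A) : `|x| = `|x.1| + `|x.2|.
Proof. by []. Qed.

Lemma unitz_cauchy_cvg (F : set_system (unitz A)) :
  ProperFilter F -> cauchy F -> cvg F.
Proof.
move=> FF /cauchy_ballP Fc.
have sub (V : completeNormedModType C) (g : unitz A -> V) :
    (forall x y, g (x - y) = g x - g y) ->
    (forall z, `|g z| <= `|z|) -> cvg (g @ F).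
  move=> gB gn; apply/cauchy_cvgP/cauchy_ballP => e e0; rewrite near_map2.
  apply: filterS (Fc _ e0) => -[x y] /=; rewrite -!ball_normE /= => xy.
  by rewrite -gB (le_lt_trans (gn _)).
have /cvg_ex[/= a Fa] : cvg ((fun x : unitz A => x.1) @ F).
  by apply: sub => // z; rewrite unitz_normE lerDl.
have /cvg_ex[/= b Fb] : cvg ((fun x : unitz A => x.2) @ F).
  by apply: sub => // z; rewrite unitz_normE lerDr.
apply/cvg_ex; exists ((a, b) : unitz A); apply/cvgrPdist_lt => /= e e0.
near=> z; rewrite unitz_normE [ltRHS]splitr; apply: ltrD => /=.
  by near: z; apply: (cvgr_dist_lt _ _ Fa); rewrite divr_gt0.
by near: z; apply: (cvgr_dist_lt _ _ Fb); rewrite divr_gt0.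
Unshelve. all: by end_near. Qed.

HB.instance Definition _ :=
  Uniform_isComplete.Build (unitz A) unitz_cauchy_cvg.

Definition unitz_mul (x y : unitz A) : unitz A :=
  (ba_mul x.1 y.1 + x.2 *: y.1 + y.2 *: x.1, x.2 * y.2).

Lemma unitz_mul_bilinear : bilinear_map unitz_mul.
Proof.
split=> [z k x y|z k x y]; rewrite /unitz_mul /=; apply: congr2 => /=.
- rewrite ba_mulPl -[k *: x.2]/(k * x.2) !scalerDr !scalerDl !scalerA.
  by rewrite [z.2 * k]mulrC !addrA [LHS](ACl (1*3*5*2*4*6)).
- by rewrite mulrDl scalerAl.
- rewrite ba_mulPr -[k *: x.2]/(k * x.2) !scalerDr !scalerDl !scalerA.
  by rewrite [z.2 * k]mulrC !addrA [LHS](ACl (1*3*5*2*4*6)).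
- by rewrite -[k *: x.2]/(k * x.2) mulrDr mulrCA.
Qed.

Lemma unitz_mulA : associative unitz_mul.
Proof.
pose m := ba_mul_bilinear A.
have mD : (forall a b c : A, ba_mul (a + b) c = ba_mul a c + ba_mul b c) /\
    (forall a b c : A, ba_mul c (a + b) = ba_mul c a + ba_mul c b).
  by split=> a b c; rewrite -[X in X + b]scale1r ?ba_mulPl ?ba_mulPr scale1r.
have mZ : (forall k (a b : A), ba_mul (k *: a) b = k *: ba_mul a b) /\
    (forall k (a b : A), ba_mul b (k *: a) = k *: ba_mul b a).
  by split=> k a b;
    [exact: (linearZ_LR (linear_pack (m.1 b)))
    |exact: (linearZ_LR (linear_pack (m.2 b)))].
move=> x y z; rewrite /unitz_mul /=; congr pair => /=; last by rewrite mulrA.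
rewrite !mD.1 !mD.2 !mZ.1 !mZ.2 ba_mulA !scalerDr !scalerA !addrA.
rewrite [z.2 * x.2]mulrC [z.2 * y.2]mulrC.
by rewrite [LHS](ACl (1*4*2*5*3*6*7)).
Qed.

Lemma unitz_norm_mul (x y : unitz A) : `|unitz_mul x y| <= `|x| * `|y|.
Proof.
rewrite !unitz_normE /= mulrDl !mulrDr normrM addrA lerD2r [leRHS]addrAC.
rewrite (le_trans (ler_normD _ _))// lerD//; last first.
  by rewrite normrZ mulrC.
by rewrite (le_trans (ler_normD _ _))// lerD ?ba_norm_mul// normrZ.
Qed.

Definition unitization : banachAlgebra R :=
  BanachAlgebra unitz_mulA unitz_mul_bilinear unitz_norm_mul.

End Unitization.
Arguments unitization : simpl never.

Section Dual.
Context {R : realType}.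
Local Notation C := R[i].
Local Open Scope complex_scope.
Variable Y : normedModType C.

Definition functional_pred : pred (Y -> C) := [pred f | `[< bounded_linear f >]].

Record dual_space := Dual {
  dual_fun :> Y -> C;
  dual_funP : functional_pred dual_fun }.

HB.instance Definition _ := [isSub for dual_fun].
HB.instance Definition _ := [Choice of dual_space by <:].

Lemma functional_submod : subsemimod_closed functional_pred.
Proof.
split; first split.
- apply: asboolT; split=> [k x y /=|].
    by rewrite -[LHS]/(0 : C) -[RHS]/(k *: (0 : C) + 0) scaler0 addr0.
  exact: cst_continuous.
- move=> f g /asboolW[lf cf] /asboolW[lg cg].
  apply: asboolT; split=> [k x y|x]; last by apply: cvgD; [exact: cf|exact: cg].
  rewrite -[LHS]/(f (k *: x + y) + g (k *: x + y)) lf lg addrACA -scalerDr.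
  by [].
- move=> k f /asboolW[lf cf].
  apply: asboolT; split=> [l x y|x]; last by apply: cvgZl_tmp; exact: cf.
  rewrite -[LHS]/(k *: f (l *: x + y)) lf scalerDr !scalerA mulrC -scalerA.
  by [].
Qed.

HB.instance Definition _ :=
  GRing.SubChoice_isSubLmodule.Build C (Y -> C) functional_pred dual_space
    functional_submod.

Lemma dual_bounded_linear (f : dual_space) : bounded_linear f.
Proof. exact/asboolP/dual_funP. Qed.

Definition dual_of (f : Y -> C) (hf : bounded_linear f) : dual_space :=
  Dual (asboolT hf : functional_pred f).

Lemma dual_ext (f g : dual_space) : f =1 g -> f = g.
Proof. by move=> fg; apply: val_inj; apply/funext. Qed.

Lemma dual_addE (f g : dual_space) x : (f + g) x = f x + g x. Proof. by []. Qed.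
Lemma dual_scaleE k (f : dual_space) x : (k *: f) x = k * f x. Proof. by []. Qed.
Lemma dual_subE (f g : dual_space) x : (f - g) x = f x - g x. Proof. by []. Qed.

(* The operator norm; the supremum is taken in R. *)
Definition dual_norm (f : dual_space) : C :=
  (sup [set Re `|f y| | y in [set y : Y | `|y| <= 1]])%:C.

Implicit Types f g : dual_space.

Let ball_set (f : dual_space) := [set Re `|f y| | y in [set y : Y | `|y| <= 1]].

Let ReK (z : C) : 0 <= z -> (Re z)%:C = z.
Proof. by move=> /ger0_real/RRe_real. Qed.

Let has_sup_ball (f : dual_space) : has_sup (ball_set f).
Proof.
split; first by exists (Re `|f 0|); exists 0 => //=; rewrite normr0 ler01.
have [lf cf] := dual_bounded_linear f.
have [c [c0 fc]] := (bounded_linearP lf).1 cf.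
exists (Re c) => _ [y /= y1 <-]; rewrite -lecR !ReK// (le_trans (fc y))//.
by rewrite ler_piMr.
Qed.

Lemma dual_norm_ge0 f : 0 <= dual_norm f.
Proof.
rewrite ler0c; apply: (@le_trans _ _ (Re `|f 0|)).
  by rewrite -ler0c ReK.
apply: (ub_le_sup (has_sup_ball f).2); exists 0 => //=.
by rewrite normr0 ler01.
Qed.

Lemma dual_norm_le f (c : C) : 0 <= c ->
  (forall y, `|f y| <= c * `|y|) -> dual_norm f <= c.
Proof.
move=> c0 fc; rewrite -(ReK c0) lecR; apply: ge_sup.
  exact: (has_sup_ball f).1.
move=> _ [y /= y1 <-]; rewrite -lecR !ReK// (le_trans (fc y))//.
by rewrite ler_piMr.
Qed.

Lemma le_dual_norm f y : `|f y| <= dual_norm f * `|y|.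
Proof.
have [lf _] := dual_bounded_linear f.
have [->|y0] := eqVneq y 0.
  have -> : f 0 = 0 := linear0 (linear_pack lf).
  by rewrite !normr0 mulr0.
have ny : 0 < `|y| by rewrite normr_gt0.
rewrite -ler_pdivrMr//.
have -> : `|f y| / `|y| = `|f (`|y|^-1 *: y)|.
  have -> : f (`|y|^-1 *: y) = `|y|^-1 *: f y := linearZ_LR (linear_pack lf) _ _.
  by rewrite normrM normfV normr_id mulrC.
rewrite -[leLHS]ReK// lecR; apply: (ub_le_sup (has_sup_ball f).2).
exists (`|y|^-1 *: y) => //=.
by rewrite normrZ normfV normr_id mulVf// gt_eqF.
Qed.

Lemma dual_normD f g : dual_norm (f + g) <= dual_norm f + dual_norm g.
Proof.
apply: dual_norm_le => [|y]; first by rewrite addr_ge0// dual_norm_ge0.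
by rewrite dual_addE (le_trans (ler_normD _ _))// mulrDl lerD// le_dual_norm.
Qed.

Let dual_normZ_le (k : C) f : dual_norm (k *: f) <= `|k| * dual_norm f.
Proof.
apply: dual_norm_le => [|y]; first by rewrite mulr_ge0// dual_norm_ge0.
by rewrite dual_scaleE normrM -mulrA ler_wpM2l// le_dual_norm.
Qed.

Lemma dual_normZ (k : C) f : dual_norm (k *: f) = `|k| * dual_norm f.
Proof.
apply/eqP; rewrite eq_le dual_normZ_le /=.
have [->|k0] := eqVneq k 0; first by rewrite normr0 mul0r dual_norm_ge0.
rewrite -ler_pdivlMl ?normr_gt0// -normfV (le_trans _ (dual_normZ_le _ _))//.
by rewrite scalerA mulVf// scale1r.
Qed.

Lemma dual_norm_eq0 f : dual_norm f = 0 -> f = 0.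
Proof.
move=> f0; apply: dual_ext => y; apply/eqP.
by rewrite -normr_le0 (le_trans (le_dual_norm _ _))// f0 mul0r.
Qed.

HB.instance Definition _ :=
  Lmodule_isNormed.Build C dual_space dual_normD dual_normZ dual_norm_eq0.

Lemma le_norm_dual (f : dual_space) y : `|f y| <= `|f| * `|y|.
Proof. exact: le_dual_norm. Qed.

Lemma norm_dual_le (f : dual_space) (c : C) : 0 <= c ->
  (forall y, `|f y| <= c * `|y|) -> `|f| <= c.
Proof. exact: dual_norm_le. Qed.

Lemma dual_cauchy_cvg (F : set_system dual_space) :
  ProperFilter F -> cauchy F -> cvg F.
Proof.
move=> FF /cauchy_ballP Fc.
have ev y : cvg ((fun f : dual_space => f y) @ F).
  apply/cauchy_cvgP/cauchy_ballP => e e0; rewrite near_map2.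
  have e0' : 0 < e / (`|y| + 1) by rewrite divr_gt0// ltr_wpDl.
  apply: filterS (Fc _ e0') => -[f g] /=; rewrite -!ball_normE /= => fg.
  rewrite -dual_subE (le_lt_trans (le_norm_dual _ _))//.
  rewrite (@le_lt_trans _ _ (`|f - g| * (`|y| + 1)))//.
    by rewrite ler_wpM2l// lerDl.
  by rewrite -ltr_pdivlMr// ltr_wpDl.
have /choice[L FL] : forall y, exists l : C, (fun f : dual_space => f y) @ F --> l.
  by move=> y; apply/cvg_ex.
have lL : linear L.
  move=> k x y; have fL := FL (k *: x + y).
  have hC := @norm_hausdorff C C.
  rewrite -(cvg_lim hC fL); apply: (cvg_lim hC).
  have -> : (fun f : dual_space => f (k *: x + y)) =
            (fun f : dual_space => k *: f x) + (fun f : dual_space => f y).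
    by apply/funext => f; rewrite (dual_bounded_linear f).1.
  apply: (@cvgD _ C); last exact: FL.
  exact: (@cvgZl_tmp _ C _ _ _ k _ _ (FL x)).
have close e : 0 < e ->
    \forall f \near F, forall y, `|L y - (f : dual_space) y| <= e * `|y|.
  move=> e0; apply: filterS (nearP_dep (Fc _ e0)) => f fF y.
  apply/ler_addgt0Pr => d d0; near F => g.
  rewrite -[L y](subrK (g y)) -addrA (le_trans (ler_normD _ _))// [leRHS]addrC.
  apply: lerD; last first.
    have fg : `|f - g| < e by near: g; move: fF; rewrite -ball_normE.
    rewrite distrC -dual_subE (le_trans (le_norm_dual _ _))//.
    by rewrite ler_wpM2r// ltW.
  by rewrite ltW//; near: g; apply: (cvgr_dist_lt _ _ (FL y)).
have cL : continuous L.
  near F => f; have fL : forall y, `|L y - f y| <= 1 * `|y|.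
    by near: f; exact: close.
  apply/(bounded_linearP lL); exists (1 + `|f|); split; first exact: addr_ge0.
  move=> y; rewrite -[L y](subrK (f y)) (le_trans (ler_normD _ _))// mulrDl.
  by rewrite lerD// le_norm_dual.
apply/cvg_ex; exists (dual_of (conj lL cL)); apply/cvgrPdist_le => /= e e0.
apply: filterS (close _ e0) => f fe; exact: norm_dual_le (ltW e0) _.
Unshelve. all: by end_near. Qed.

HB.instance Definition _ := Uniform_isComplete.Build dual_space dual_cauchy_cvg.

End Dual.

Section Modules.
Context {R : realType}.
Local Notation C := R[i].
Implicit Types (B : banachAlgebra R) (V W Y : completeNormedModType C).

Definition is_left_action B V (l : B -> V -> V) : Prop :=
  bounded_bilinear l /\ forall a b x, l (ba_mul a b) x = l a (l b x).

Definition is_right_action B V (r : V -> B -> V) : Prop :=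
  bounded_bilinear r /\ forall x a b, r x (ba_mul a b) = r (r x a) b.

Record lmodule B := LModule {
  lm_space :> completeNormedModType C;
  lm_act : B -> lm_space -> lm_space;
  lm_actP : is_left_action lm_act }.

Record rmodule B := RModule {
  rm_space :> completeNormedModType C;
  rm_act : rm_space -> B -> rm_space;
  rm_actP : is_right_action rm_act }.

Record bimodule B := Bimodule {
  bm_space :> completeNormedModType C;
  bm_lact : B -> bm_space -> bm_space;
  bm_ract : bm_space -> B -> bm_space;
  bm_lactP : is_left_action bm_lact;
  bm_ractP : is_right_action bm_ract;
  bm_actA : forall a x b, bm_ract (bm_lact a x) b = bm_lact a (bm_ract x b) }.

Lemma bounded_bilinear_flip (U V' W' : normedModType C) (m : U -> V' -> W') :
  bounded_bilinear m -> bounded_bilinear (fun v u => m u v).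
Proof.
move=> [[ml mr] /bounded_bilinearP[//|c [c0 mc]]].
have bm : bilinear_map (fun v u => m u v) by split.
split=> //; apply/(bounded_bilinearP bm); exists c; split=> // u v.
by rewrite mulrAC.
Qed.

Lemma bounded_bilinearr (U V' W' : normedModType C) (m : U -> V' -> W') u :
  bounded_bilinear m -> bounded_linear (m u).
Proof.
move=> [[ml mr] /bounded_bilinearP[//|c [c0 mc]]]; split; first exact: mr.
apply/(bounded_linearP (mr u)); exists (c * `|u|); split=> //.
exact: mulr_ge0.
Qed.

Lemma bounded_linear_comp (U V' W' : normedModType C) (g : V' -> W')
    (f : U -> V') :
  bounded_linear g -> bounded_linear f -> bounded_linear (fun x => g (f x)).
Proof.
move=> [lg cg] [lf cf]; split=> [k x y|]; first by rewrite lf lg.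
by move=> x; apply: continuous_comp; [exact: cf|exact: cg].
Qed.

(* For an action m of B on Y, on either side, dual_act m b f = f \o m b. *)
Definition dual_act B Y (m : B -> Y -> Y) (hm : bounded_bilinear m)
    (b : B) (f : dual_space Y) : dual_space Y :=
  dual_of (bounded_linear_comp (dual_bounded_linear f)
                               (bounded_bilinearr b hm)).

Lemma dual_act_bilinear B Y (m : B -> Y -> Y) (hm : bounded_bilinear m) :
  bounded_bilinear (dual_act hm).
Proof.
have bm : bilinear_map (dual_act hm).
  split=> [f k a b|b k f g]; apply: dual_ext => y //.
  rewrite /= hm.1.1 (dual_bounded_linear f).1.
  by [].
split=> //; apply/(bounded_bilinearP bm).
have [c [c0 mc]] := (bounded_bilinearP hm.1).1 hm.2.
exists c; split=> // b f; apply: norm_dual_le => [|y].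
  by rewrite !mulr_ge0.
rewrite /= (le_trans (le_norm_dual _ _))// mulrC.
rewrite (le_trans (ler_wpM2r _ (mc b y)))//.
by rewrite mulrAC.
Qed.

Lemma dual_lactP B (Y : rmodule B) :
  is_left_action (dual_act (bounded_bilinear_flip (rm_actP Y).1)).
Proof.
split=> [|a b f]; first exact: dual_act_bilinear.
by apply: dual_ext => y /=; rewrite (rm_actP Y).2.
Qed.

(* (b . f)(y) = f (y . b) *)
Definition dual_lmodule B (Y : rmodule B) : lmodule B :=
  LModule (dual_lactP Y).

Lemma dual_bimod_lactP B (X : bimodule B) :
  is_left_action (dual_act (bounded_bilinear_flip (bm_ractP X).1)).
Proof. exact: (@dual_lactP _ (RModule (bm_ractP X))). Qed.

Lemma dual_bimod_ractP B (X : bimodule B) :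
  is_right_action (fun f b => dual_act (bm_lactP X).1 b f).
Proof.
split=> [|f a b]; last by apply: dual_ext => x /=; rewrite (bm_lactP X).2.
exact/bounded_bilinear_flip/dual_act_bilinear.
Qed.

Lemma dual_bimod_actA B (X : bimodule B) (a : B) (f : dual_space X) (b : B) :
  let l := dual_act (bounded_bilinear_flip (bm_ractP X).1) in
  let r f b := dual_act (bm_lactP X).1 b f in
  r (l a f) b = l a (r f b).
Proof. by apply: dual_ext => x /=; rewrite bm_actA. Qed.

(* (a . f)(x) = f (x . a) and (f . a)(x) = f (a . x) *)
Definition dual_bimodule B (X : bimodule B) : bimodule B :=
  Bimodule (dual_bimod_lactP X) (dual_bimod_ractP X) (@dual_bimod_actA B X).

End Modules.

Section Hochschild.
Context {R : realType}.
Variables (A : banachAlgebra R) (X : bimodule A).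
Local Notation C := R[i].

Definition multilinear n (f : ('I_n -> A) -> X) : Prop :=
  forall (a : 'I_n -> A) (i : 'I_n), linear (fun x => f [eta a with i |-> x]).

(* For multilinear maps, boundedness is the same as continuity. *)
Definition hochschild_cochain n (f : ('I_n -> A) -> X) : Prop :=
  multilinear f /\
  exists M : C, forall a, `|f a| <= M * \prod_(i < n) `|a i|.

(* (a_0, ..., a_n) |-> (a_0, ..., a_k a_(k+1), ..., a_n) *)
Definition contract n (k : 'I_n) (a : 'I_n.+1 -> A) (i : 'I_n) : A :=
  if (i < k)%N then a (widen_ord (leqnSn n) i)
  else if i == k then ba_mul (a (widen_ord (leqnSn n) i)) (a (lift ord0 i))
  else a (lift ord0 i).

Definition hochschild_d n (f : ('I_n -> A) -> X) (a : 'I_n.+1 -> A) : X :=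
  bm_lact (a ord0) (f (fun i => a (lift ord0 i)))
  + \sum_(k < n) (-1) ^+ k.+1 *: f (contract k a)
  + (-1) ^+ n.+1 *: bm_ract (f (fun i => a (widen_ord (leqnSn n) i)))
                            (a ord_max).

Definition hochschild_cocycle n (f : ('I_n -> A) -> X) : Prop :=
  hochschild_cochain f /\ forall a, hochschild_d f a = 0.

Definition hochschild_coboundary n : (('I_n -> A) -> X) -> Prop :=
  match n with
  | 0 => fun f => forall a, f a = 0
  | m.+1 => fun f => exists2 g : ('I_m -> A) -> X,
      hochschild_cochain g & forall a, f a = hochschild_d g a
  end.

(* The topology of H^n(A, X) is trivial: the coboundaries are dense in the
   cocycles for the norm of multilinear maps. *)
Definition hochschild_trivial_topology n : Prop :=
  forall f : ('I_n -> A) -> X, hochschild_cocycle f ->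
  forall e : C, 0 < e -> exists2 g : ('I_n -> A) -> X, hochschild_coboundary g
    & forall a, `|f a - g a| <= e * \prod_(i < n) `|a i|.

End Hochschild.

Section Ext.
Context {R : realType}.
Variable B : banachAlgebra R.
Implicit Types X Y P : lmodule B.

Definition module_morphism X Y (f : X -> Y) : Prop :=
  bounded_linear f /\ forall b x, f (lm_act b x) = lm_act b (f x).

Definition projective P : Prop :=
  forall X Y (q : X -> Y) (f : P -> Y),
    module_morphism q ->
    (exists2 s : Y -> X, bounded_linear s & forall y, q (s y) = y) ->
    module_morphism f ->
  exists2 g : P -> X, module_morphism g & forall p, q (g p) = f p.

(* res_sX and res_s form a contracting homotopy of the augmented complex
   by bounded linear maps. *)
Record projective_resolution X := ProjectiveResolution {
  res_mod :> nat -> lmodule B;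
  res_d : forall n, res_mod n.+1 -> res_mod n;
  res_aug : res_mod 0 -> X;
  res_projective : forall n, projective (res_mod n);
  res_d_morphism : forall n, module_morphism (@res_d n);
  res_aug_morphism : module_morphism res_aug;
  res_dd : forall n x, res_d (res_d x : res_mod n.+1) = 0;
  res_augd : forall x, res_aug (res_d x) = 0;
  res_split : exists (sX : X -> res_mod 0)
                     (s : forall n, res_mod n -> res_mod n.+1),
    [/\ bounded_linear sX, forall n, bounded_linear (s n),
        forall x, res_aug (sX x) = x,
        forall x, sX (res_aug x) + res_d (s 0 x) = x
      & forall n x, s n (res_d x) + res_d (s n.+1 x) = x] }.

Definition ext_cocycle X (P : projective_resolution X) Y n
    (f : P n -> Y) : Prop :=
  module_morphism f /\ forall x, f (res_d x) = 0.

Definition ext_coboundary X (P : projective_resolution X) Y n :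
    (P n -> Y) -> Prop :=
  match n with
  | 0 => fun f => forall x, f x = 0
  | m.+1 => fun f => exists2 g : P m -> Y,
      module_morphism g & forall x, f x = g (res_d x)
  end.

(* Ext^n_B(X, Y) = 0; it does not depend on the projective resolution. *)
Definition ext_vanishes n X Y : Prop :=
  forall (P : projective_resolution X) (f : P n -> Y),
    ext_cocycle f -> ext_coboundary f.

(* The infimum of a set of natural numbers is its least element, and +oo if
   the set is empty. *)
Definition dh X : \bar R :=
  ereal_inf [set m%:R%:E | m in [set m : nat | forall Y, ext_vanishes m.+1 X Y]].

Definition w_dh X : \bar R :=
  ereal_inf [set m%:R%:E | m in [set m : nat |
    forall Y : rmodule B, ext_vanishes m.+1 X (dual_lmodule Y)]].

End Ext.

Section Enveloping.
Context {R : realType}.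
Local Notation C := R[i].

(* T together with t is the completed projective tensor product of U and V:
   this universal property determines (T, t) up to isometric isomorphism. *)
Definition is_projective_tensor (U V T : completeNormedModType C)
    (t : U -> V -> T) : Prop :=
  [/\ bilinear_map t, forall u v, `|t u v| <= `|u| * `|v| &
      forall (W : completeNormedModType C) (f : U -> V -> W) (c : C),
        bilinear_map f -> 0 <= c -> (forall u v, `|f u v| <= c * `|u| * `|v|) ->
      exists! g : T -> W, [/\ linear g, forall x, `|g x| <= c * `|x| &
                              forall u v, g (t u v) = f u v]].

(* The Banach algebra structure of the projective tensor product of B1, B2. *)
Record tensor_algebra (B1 B2 : banachAlgebra R) := TensorAlgebra {
  ta_alg :> banachAlgebra R;
  ta_tens : B1 -> B2 -> ta_alg;
  ta_tensP : is_projective_tensor ta_tens;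
  ta_mul : forall a b c d, ba_mul (ta_tens a b) (ta_tens c d) =
                           ta_tens (ba_mul a c) (ba_mul b d) }.

Section Opposite.
Variable B : banachAlgebra R.

Lemma op_mulA : associative (fun a b : B => ba_mul b a).
Proof. by move=> a b c; rewrite ba_mulA. Qed.

Lemma op_mul_bilinear : bilinear_map (fun a b : B => ba_mul b a).
Proof. by have [? ?] := ba_mul_bilinear B; split. Qed.

Lemma op_norm_mul (a b : B) : `|ba_mul b a| <= `|a| * `|b|.
Proof. by rewrite mulrC ba_norm_mul. Qed.

Definition opposite : banachAlgebra R :=
  BanachAlgebra op_mulA op_mul_bilinear op_norm_mul.
End Opposite.

Definition enveloping_algebra (A : banachAlgebra R) :=
  tensor_algebra (unitization A) (opposite (unitization A)).

End Enveloping.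

Section TensorMaps.
Context {R : realType}.
Local Notation C := R[i].
Variables (U V T : completeNormedModType C) (t : U -> V -> T).
Hypothesis tP : is_projective_tensor t.

Lemma tensor_ext (W : completeNormedModType C) (g h : T -> W) :
  bounded_linear g -> bounded_linear h ->
  (forall u v, g (t u v) = h (t u v)) -> g = h.
Proof.
have [bt nt ut] := tP => -[lg cg] [lh ch] gh.
have [c [c0 gc]] := (bounded_linearP lg).1 cg.
have [d [d0 hd]] := (bounded_linearP lh).1 ch.
have [||u v|f [_ fu]] := ut W (fun u v => g (t u v)) (c + d).
- by split=> [v k x y|u k x y]; rewrite ?bt.1 ?bt.2 lg.
- exact: addr_ge0.
- rewrite (le_trans (gc _))// -mulrA ler_pM//.
  by rewrite lerDl.
have <- : f = g.
  apply: fu; split=> // x.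
  by rewrite (le_trans (gc _))// ler_wpM2r// lerDl.
apply: fu; split=> // x.
by rewrite (le_trans (hd _))// ler_wpM2r// lerDr.
Qed.

End TensorMaps.

Section UnitizationModule.
Context {R : realType}.
Local Notation C := R[i].
Variables (A : banachAlgebra R) (Ae : enveloping_algebra A).
Local Notation Ap := (unitization A).
Local Notation t := (@ta_tens _ _ _ Ae).

Lemma unitization_act_ex (x : Ap) : exists g : Ae -> Ap,
  [/\ linear g, forall u, `|g u| <= `|x| * `|u| &
      forall a b : Ap, g (t a b) = ba_mul (ba_mul a x) b].
Proof.
have [_ _ ut] := ta_tensP Ae.
have [||a b|g [gP _]] := ut Ap (fun a b => ba_mul (ba_mul a x) b) `|x|.
- split=> [b k a a'|a k b b']; cbv beta; last by rewrite ba_mulPr.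
  by rewrite !ba_mulPl.
- exact: normr_ge0.
- rewrite (le_trans (ba_norm_mul _ _))// ler_wpM2r//.
  by rewrite (le_trans (ba_norm_mul _ _))// mulrC.
by exists g.
Qed.

(* The unique bounded left action of Ae on A_+ with (a (x) b) . x = a x b *)
Definition unitization_act (u : Ae) (x : Ap) : Ap :=
  sval (cid (unitization_act_ex x)) u.

Lemma unitization_act_tens (a b x : Ap) :
  unitization_act (t a b) x = ba_mul (ba_mul a x) b.
Proof. by rewrite /unitization_act; case: cid => g []. Qed.

Lemma unitization_act_linear x : linear (unitization_act^~ x).
Proof. by rewrite /unitization_act; case: cid => g []. Qed.

Lemma unitization_act_norm u x : `|unitization_act u x| <= `|x| * `|u|.
Proof. by rewrite /unitization_act; case: cid => g []. Qed.

Lemma unitization_act_bounded x : bounded_linear (unitization_act^~ x).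
Proof.
split; first exact: unitization_act_linear.
apply/(bounded_linearP (@unitization_act_linear x)); exists `|x|.
by split=> // u; exact: unitization_act_norm.
Qed.

Lemma unitization_act_bilinear : bilinear_map unitization_act.
Proof.
split=> [x|u k x y]; first exact: unitization_act_linear.
have bl : bounded_linear
    (fun u => k *: unitization_act u x + unitization_act u y).
  have ll : linear (fun u => k *: unitization_act u x + unitization_act u y).
    move=> l a b; rewrite !unitization_act_linear !scalerDr !scalerA mulrC.
    by rewrite addrACA.
  split=> //; apply/(bounded_linearP ll); exists (`|k| * `|x| + `|y|).
  split=> [|v]; first by rewrite addr_ge0// mulr_ge0.
  rewrite (le_trans (ler_normD _ _))// mulrDl lerD ?unitization_act_norm//.
  by rewrite normrZ -mulrA ler_wpM2l// unitization_act_norm.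
have := tensor_ext (ta_tensP Ae) (unitization_act_bounded (k *: x + y)) bl.
move=> /(_ _)/(congr1 (fun g => g u)); apply=> a b.
by rewrite !unitization_act_tens !(ba_mulPr, ba_mulPl).
Qed.

Lemma unitization_act_left_action : is_left_action unitization_act.
Proof.
have bb : bounded_bilinear unitization_act.
  split; first exact: unitization_act_bilinear.
  apply/(bounded_bilinearP unitization_act_bilinear).
  exists 1; split=> // u x; rewrite mul1r mulrC.
  exact: unitization_act_norm.
have bm : bounded_bilinear (@ba_mul _ Ae).
  have bmAe := ba_mul_bilinear Ae; split=> //.
  apply/(bounded_bilinearP bmAe); exists 1; split=> // u v.
  by rewrite mul1r ba_norm_mul.
have bmf := bounded_bilinear_flip bm; have bbf := bounded_bilinear_flip bb.
split=> // u v x.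
have step c d w :
    unitization_act (ba_mul w (t c d)) x =
    unitization_act w (unitization_act (t c d) x).
  have := tensor_ext (ta_tensP Ae)
    (bounded_linear_comp (unitization_act_bounded x)
                         (bounded_bilinearr (t c d) bmf))
    (unitization_act_bounded (unitization_act (t c d) x)).
  move=> /(_ _)/(congr1 (fun g => g w)); apply=> a b.
  by rewrite ta_mul !unitization_act_tens !ba_mulA.
have := tensor_ext (ta_tensP Ae)
  (bounded_linear_comp (unitization_act_bounded x) (bounded_bilinearr u bm))
  (bounded_linear_comp (bounded_bilinearr u bb) (unitization_act_bounded x)).
by move=> /(_ _)/(congr1 (fun g => g v)); apply=> c d; exact: step.
Qed.

Definition unitization_module : lmodule Ae :=
  LModule unitization_act_left_action.

End UnitizationModule.

Definition db (R : realType) (A : banachAlgebra R)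
  (Ae : enveloping_algebra A) : \bar R := dh (unitization_module Ae).

Definition w_db (R : realType) (A : banachAlgebra R)
  (Ae : enveloping_algebra A) : \bar R := w_dh (unitization_module Ae).

(* Main.v *)
Require Import Defs.
From HB Require Import structures.
From mathcomp Require Import all_boot all_order all_algebra complex sesquilinear.
From mathcomp Require Import all_classical all_reals ereal topology normedtype.

Set Implicit Arguments.
Unset Strict Implicit.
Unset Printing Implicit Defensive.

Import Order.TTheory GRing.Theory Num.Theory numFieldNormedType.Exports.
Local Open Scope classical_set_scope.
Local Open Scope ring_scope.

(** Let P be a projective resolution of A_+ and K the n-th syzygy, the image of
    d : P_(n+1) -> P_n.  The map d : P_(n+1) -> K is an Ext cocycle, and it
    corresponds to a Hochschild cocycle c : A^(n+1) -> K.  If the coboundaries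
    are dense in the cocycles with values in K, then c is a coboundary up to an
    error that is arbitrarily small; this error is represented by a module map
    rho : K -> K, which can be taken of norm at most 1/2.  As 1 - rho is
    invertible (Neumann series), c is a coboundary, i.e., d extends to a module
    map h : P_n -> K with h d = d, and every cocycle P_(n+1) -> Y, which factors
    through K, extends to P_n.  For (ii) replace K by its bidual K^**: module
    maps K -> Y^* still extend to K^**.

    The comparison of Ext with Hochschild cohomology does not use tensor
    products: both are shifted in degree by the exact sequence of bimodules
    0 -> W -> L(A_+, W) -> L(A, W) -> 0, whose middle term is coinduced from left
    modules, and P splits as a complex of left modules.  Smallness of rho is
    obtained without estimates on the comparison, by applying it to the bounded
    sequences of K (see small_error). *)

(** * Banach spaces of bounded functions *)

(** An [lmodule] over [Ae] carries no unit axiom: 1 ⊗ 1 acts as an idempotent that may be proper,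
    even on the modules of P, while bimodules over A correspond to unital modules only. Hence K is
    the unital part of the image of [d], many identities hold only up to [lm_act one], and the
    complementary part of a cocycle, on which [Ae] acts as zero, is extended separately at the end.

    The bidual in (ii) answers two demands on the coefficients E. The density hypothesis must apply
    to E, so E has to be a dual; and the error rho : K -> E must extend to an endomorphism r of E
    with the same bound, since only 1 - r can be inverted. The canonical extension of operators from
    K to its bidual meets both. Any constant below 1 would serve in place of 1/2. Density is invoked
    only with values in E, so in (ii) no predual of the space of bounded sequences comes into
    play. *)

Section BoundedLinear.
Context {R : realType}.
Local Notation C := R[i].
Implicit Types U V W : normedModType C.

Lemma bounded_linear_le U V (f : U -> V) (c : C) : linear f -> 0 <= c ->
  (forall x, `|f x| <= c * `|x|) -> bounded_linear f.
Proof. by move=> lf c0 fc; split=> //; apply/(bounded_linearP lf); exists c. Qed.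

Lemma bounded_linear_bound U V (f : U -> V) : bounded_linear f ->
  exists2 c : C, 0 <= c & forall x, `|f x| <= c * `|x|.
Proof. by move=> [lf /(bounded_linearP lf)[c [c0 fc]]]; exists c. Qed.

Lemma bounded_bilinear_le U V W (f : U -> V -> W) (c : C) : bilinear_map f ->
  0 <= c -> (forall x y, `|f x y| <= c * `|x| * `|y|) -> bounded_bilinear f.
Proof. by move=> lf c0 fc; split=> //; apply/(bounded_bilinearP lf); exists c. Qed.

Lemma bounded_bilinear_bound U V W (f : U -> V -> W) : bounded_bilinear f ->
  exists2 c : C, 0 <= c & forall x y, `|f x y| <= c * `|x| * `|y|.
Proof. by move=> [lf /(bounded_bilinearP lf)[c [c0 fc]]]; exists c. Qed.

Section Linear.
Variables (U V : normedModType C) (f : U -> V).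
Hypothesis bf : bounded_linear f.

Lemma bl0 : f 0 = 0.
Proof. exact: (linear0 (linear_pack bf.1)). Qed.
Lemma blD x y : f (x + y) = f x + f y.
Proof. exact: (linearD (linear_pack bf.1)). Qed.
Lemma blB x y : f (x - y) = f x - f y.
Proof. exact: (linearB (linear_pack bf.1)). Qed.
Lemma blZ k x : f (k *: x) = k *: f x.
Proof. exact: (linearZ_LR (linear_pack bf.1)). Qed.
Lemma bl_sum I (r : seq I) (F : I -> U) :
  f (\sum_(i <- r) F i) = \sum_(i <- r) f (F i).
Proof. exact: (linear_sum (linear_pack bf.1)). Qed.
End Linear.

Lemma bounded_linear_id U : bounded_linear (fun x : U => x).
Proof. by apply: (@bounded_linear_le _ _ _ 1) => // x; rewrite mul1r. Qed.

Lemma bounded_linear_comb U V (k : C) (f g : U -> V) :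
  bounded_linear f -> bounded_linear g ->
  bounded_linear (fun x => k *: f x + g x).
Proof.
move=> [lf cf] [lg cg]; split=> [l x y|x].
  by rewrite lf lg !scalerDr !scalerA mulrC addrACA.
apply: cvgD; last exact: cg.
by apply: cvgZl_tmp; exact: cf.
Qed.

Lemma bounded_linear0 U V : bounded_linear (fun _ : U => 0 : V).
Proof.
apply: (@bounded_linear_le _ _ _ 0) => // [k x y|x].
  by rewrite scaler0 addr0.
by rewrite normr0 mul0r.
Qed.

Lemma bounded_linearZ U V (k : C) (f : U -> V) :
  bounded_linear f -> bounded_linear (fun x => k *: f x).
Proof.
move=> bf; have := bounded_linear_comb k bf (bounded_linear0 U V).
by congr bounded_linear; apply/funext => x; rewrite addr0.
Qed.

Lemma bounded_linearD U V (f g : U -> V) :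
  bounded_linear f -> bounded_linear g -> bounded_linear (fun x => f x + g x).
Proof.
move=> bf bg; have := bounded_linear_comb 1 bf bg.
by congr bounded_linear; apply/funext => x; rewrite scale1r.
Qed.

Lemma bounded_linearB U V (f g : U -> V) :
  bounded_linear f -> bounded_linear g -> bounded_linear (fun x => f x - g x).
Proof.
move=> bf bg; have := bounded_linear_comb (-1) bg bf.
by congr bounded_linear; apply/funext => x; rewrite scaleN1r addrC.
Qed.

End BoundedLinear.

Section BoundedFunctions.
Context {R : realType}.
Local Notation C := R[i].
Local Open Scope complex_scope.

(* Bounded operators, bounded sequences and closed subspaces (as functions on
   a point) are all Banach spaces of functions f : S -> V that satisfy a closed
   linear condition and a bound |f s| <= c * w s; the norm is the least c. *)
Record bfun_data (S : Type) (V : completeNormedModType C) := BfunData {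
  bf_weight : S -> C;
  bf_pred : (S -> V) -> Prop;
  bf_weight_ge0 : forall s, 0 <= bf_weight s;
  bf_pred0 : bf_pred (fun=> 0);
  bf_lin : forall k f g, bf_pred f -> bf_pred g ->
    bf_pred (fun s => k *: f s + g s);
  bf_closed : forall f, (forall e : C, 0 < e -> exists2 g, bf_pred g &
    forall s, `|f s - g s| <= e * bf_weight s) -> bf_pred f }.

Context {S : Type} {V : completeNormedModType C}.
Variable D : bfun_data S V.
Local Notation w := (bf_weight D).

Definition bfun_prop (f : S -> V) : Prop :=
  bf_pred D f /\ exists2 c, 0 <= c & forall s, `|f s| <= c * w s.

Definition bfun_mem : pred (S -> V) := [pred f | `[< bfun_prop f >]].

Record bfun := Bfun { bfun_fun :> S -> V; bfun_memP : bfun_mem bfun_fun }.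

HB.instance Definition _ := [isSub for bfun_fun].
HB.instance Definition _ := [Choice of bfun by <:].

Lemma bfun_prop_comb k f g : bfun_prop f -> bfun_prop g ->
  bfun_prop (fun s => k *: f s + g s).
Proof.
move=> [Lf [c c0 fc]] [Lg [d d0 gd]]; split; first exact: bf_lin.
exists (`|k| * c + d) => [|s]; first by rewrite addr_ge0// mulr_ge0.
rewrite (le_trans (ler_normD _ _))// mulrDl lerD// normrZ -mulrA.
by rewrite ler_wpM2l.
Qed.

Lemma bfun_prop0 : bfun_prop (fun=> 0).
Proof.
split; first exact: bf_pred0.
by exists 0 => // s; rewrite normr0 mul0r.
Qed.

Lemma bfun_submod : subsemimod_closed bfun_mem.
Proof.
split; first split.
- exact/asboolT/bfun_prop0.
- move=> f g /asboolW Pf /asboolW Pg; apply: asboolT.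
  have := bfun_prop_comb 1 Pf Pg.
  by congr bfun_prop; apply/funext => s; rewrite scale1r.
- move=> k f /asboolW Pf; apply: asboolT.
  have := bfun_prop_comb k Pf bfun_prop0.
  by congr bfun_prop; apply/funext => s; rewrite addr0.
Qed.

HB.instance Definition _ :=
  GRing.SubChoice_isSubLmodule.Build C (S -> V) bfun_mem bfun bfun_submod.

Lemma bfunP (f : bfun) : bfun_prop f.
Proof. exact/asboolP/bfun_memP. Qed.

Lemma bfun_ext (f g : bfun) : f =1 g -> f = g.
Proof. by move=> fg; apply: val_inj; apply/funext. Qed.

Lemma bfunDE (f g : bfun) s : (f + g) s = f s + g s. Proof. by []. Qed.
Lemma bfunBE (f g : bfun) s : (f - g) s = f s - g s. Proof. by []. Qed.
Lemma bfunZE k (f : bfun) s : (k *: f) s = k *: f s. Proof. by []. Qed.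
Lemma bfun0E s : (0 : bfun) s = 0. Proof. by []. Qed.

(* The zero function when f does not satisfy the condition. *)
Definition mkbfun (f : S -> V) : bfun :=
  if pselect (bfun_prop f) is left h then Bfun (asboolT h : bfun_mem f) else 0.

Lemma mkbfunE f : bfun_prop f -> mkbfun f = f :> (S -> V).
Proof. by rewrite /mkbfun; case: pselect. Qed.

Implicit Types f g : bfun.

Let bounds f :=
  [set r : R | 0 <= r /\ forall s, `|f s| <= r%:C * w s].

Definition bfun_norm (f : bfun) : C := (inf (bounds f))%:C.

Let ReK (z : C) : 0 <= z -> (complex.Re z)%:C = z.
Proof. by move=> /ger0_real/RRe_real. Qed.

Let bounds_inf f : has_inf (bounds f).
Proof.
split; last by exists 0 => r [].
have [_ [c c0 fc]] := bfunP f.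
by exists (complex.Re c); rewrite /bounds/= -ler0c ReK.
Qed.

Lemma bfun_norm_ge0 f : 0 <= bfun_norm f.
Proof.
rewrite ler0c; apply: lb_le_inf; first exact: (bounds_inf f).1.
by move=> r [].
Qed.

Lemma bfun_norm_le f (c : C) : 0 <= c ->
  (forall s, `|f s| <= c * w s) -> bfun_norm f <= c.
Proof.
move=> c0 fc; rewrite -(ReK c0) lecR; apply: ge_inf.
  exact: (bounds_inf f).2.
by rewrite /bounds/= -ler0c ReK.
Qed.

Lemma le_bfun_norm f s : `|f s| <= bfun_norm f * w s.
Proof.
have w0 := bf_weight_ge0 D s.
(* Where the weight vanishes one cannot divide by it, but any admissible bound already forces f s =
   0. *)
have [ws0|ws] := eqVneq (w s) 0.
  by have [_ [c _ /(_ s)]] := bfunP f; rewrite ws0 !mulr0.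
have wp : 0 < w s by rewrite lt_def ws w0.
rewrite -ler_pdivrMr// -[leLHS]ReK ?divr_ge0// lecR.
apply: lb_le_inf; first exact: (bounds_inf f).1.
move=> r [_ /(_ s) fr]; rewrite -lecR ReK ?divr_ge0//.
by rewrite ler_pdivrMr.
Qed.

Lemma bfun_normD f g : bfun_norm (f + g) <= bfun_norm f + bfun_norm g.
Proof.
apply: bfun_norm_le => [|s]; first by rewrite addr_ge0// bfun_norm_ge0.
by rewrite bfunDE (le_trans (ler_normD _ _))// mulrDl lerD// le_bfun_norm.
Qed.

Let bfun_normZ_le (k : C) f : bfun_norm (k *: f) <= `|k| * bfun_norm f.
Proof.
apply: bfun_norm_le => [|s]; first by rewrite mulr_ge0// bfun_norm_ge0.
by rewrite bfunZE normrZ -mulrA ler_wpM2l// le_bfun_norm.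
Qed.

Lemma bfun_normZ (k : C) f : bfun_norm (k *: f) = `|k| * bfun_norm f.
Proof.
apply/eqP; rewrite eq_le bfun_normZ_le /=.
have [->|k0] := eqVneq k 0; first by rewrite normr0 mul0r bfun_norm_ge0.
rewrite -ler_pdivlMl ?normr_gt0// -normfV (le_trans _ (bfun_normZ_le _ _))//.
by rewrite scalerA mulVf// scale1r.
Qed.

Lemma bfun_norm_eq0 f : bfun_norm f = 0 -> f = 0.
Proof.
move=> f0; apply: bfun_ext => s; apply/eqP.
by rewrite -normr_le0 (le_trans (le_bfun_norm _ _))// f0 mul0r.
Qed.

HB.instance Definition _ :=
  Lmodule_isNormed.Build C bfun bfun_normD bfun_normZ bfun_norm_eq0.

Lemma le_norm_bfun (f : bfun) s : `|f s| <= `|f| * w s.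
Proof. exact: le_bfun_norm. Qed.

Lemma norm_bfun_le (f : bfun) (c : C) : 0 <= c ->
  (forall s, `|f s| <= c * w s) -> `|f| <= c.
Proof. exact: bfun_norm_le. Qed.

(** A Cauchy filter converges at every point; the Cauchy condition makes this convergence uniform
    relative to the weight, and [bf_closed] carries the linear condition over to the limit. *)
Lemma bfun_cauchy_cvg (F : set_system bfun) :
  ProperFilter F -> cauchy F -> cvg F.
Proof.
move=> FF /cauchy_ballP Fc.
have wp s : 0 < w s + 1 by rewrite ltr_wpDl// bf_weight_ge0.
have ev s : cvg ((fun f : bfun => f s) @ F).
  apply/cauchy_cvgP/cauchy_ballP => e e0; rewrite near_map2.
  apply: filterS (Fc _ (divr_gt0 e0 (wp s))) => -[f g] /=.
  rewrite -!ball_normE /= => fg.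
  rewrite -bfunBE (le_lt_trans (le_norm_bfun _ _))//.
  rewrite (@le_lt_trans _ _ (`|f - g| * (w s + 1)))//.
    by rewrite ler_wpM2l// lerDl.
  by rewrite -ltr_pdivlMr.
have /choice[L FL] : forall s, exists l : V, (fun f : bfun => f s) @ F --> l.
  by move=> s; apply/cvg_ex.
have close e : 0 < e ->
    \forall f \near F, forall s, `|L s - (f : bfun) s| <= e * w s.
  move=> e0; apply: filterS (nearP_dep (Fc _ e0)) => f fF s.
  apply/ler_addgt0Pr => d d0; near F => g.
  rewrite -[L s](subrK (g s)) -addrA (le_trans (ler_normD _ _))// [leRHS]addrC.
  apply: lerD; last first.
    have fg : `|f - g| < e by near: g; move: fF; rewrite -ball_normE.
    rewrite distrC -bfunBE (le_trans (le_norm_bfun _ _))//.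
    by rewrite ler_wpM2r ?bf_weight_ge0// ltW.
  by rewrite ltW//; near: g; apply: (cvgr_dist_lt _ _ (FL s)).
have PL : bfun_prop L.
  split.
    apply: (@bf_closed _ _ D) => e e0; near F => f; exists f.
      exact: (bfunP f).1.
    by near: f; exact: close.
  near F => f; have fL : forall s, `|L s - f s| <= 1 * w s.
    by near: f; exact: close.
  exists (1 + `|f|) => [|s]; first exact: addr_ge0.
  rewrite -[L s](subrK (f s)) (le_trans (ler_normD _ _))// mulrDl.
  by rewrite lerD// le_norm_bfun.
apply/cvg_ex; exists (mkbfun L); apply/cvgrPdist_le => /= e e0.
apply: filterS (close _ e0) => f fe; apply: norm_bfun_le (ltW e0) _ => s.
by rewrite bfunBE mkbfunE.
Unshelve. all: by end_near. Qed.

HB.instance Definition _ := Uniform_isComplete.Build bfun bfun_cauchy_cvg.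

Lemma bounded_linear_eval s : bounded_linear (fun f : bfun => f s).
Proof.
apply: (@bounded_linear_le _ _ _ _ (w s)) => //; first exact: bf_weight_ge0.
by move=> f; rewrite mulrC le_norm_bfun.
Qed.

Lemma bfun_sumE I (r : seq I) (F : I -> bfun) s :
  (\sum_(i <- r) F i) s = \sum_(i <- r) F i s.
Proof. exact: (bl_sum (bounded_linear_eval s)). Qed.

End BoundedFunctions.

Local Notation "a *> x" := (bm_lact a x) (at level 40).
Local Notation "x <* a" := (bm_ract x a) (at level 40).

(** * Bimodules over A and modules over the enveloping algebra *)

Section Bimodules.
Context {R : realType} {A : banachAlgebra R}.
Local Notation C := R[i].
Local Notation Ap := (unitization A).
Implicit Types (X Y : bimodule A).

Lemma lact_bl X a : bounded_linear (fun x : X => a *> x).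
Proof. exact: bounded_bilinearr (bm_lactP X).1. Qed.
Lemma ract_bl X a : bounded_linear (fun x : X => x <* a).
Proof. exact: bounded_bilinearr (bounded_bilinear_flip (bm_ractP X).1). Qed.
Lemma lact_bl_alg X (x : X) : bounded_linear (fun a => a *> x).
Proof. exact: bounded_bilinearr (bounded_bilinear_flip (bm_lactP X).1). Qed.
Lemma ract_bl_alg X (x : X) : bounded_linear (fun a => x <* a).
Proof. exact: bounded_bilinearr (bm_ractP X).1. Qed.
Lemma mul_bl (B : banachAlgebra R) (a : B) : bounded_linear (ba_mul a).
Proof.
by apply: (@bounded_linear_le _ _ _ _ `|a|) (ba_norm_mul a); rewrite //;
  exact: (ba_mul_bilinear B).2.
Qed.
Lemma mulr_bl (B : banachAlgebra R) (a : B) : bounded_linear (ba_mul^~ a).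
Proof.
apply: (@bounded_linear_le _ _ _ _ `|a|) => //.
  exact: (ba_mul_bilinear B).1.
by move=> x; rewrite mulrC ba_norm_mul.
Qed.
Lemma lactA X a b (x : X) : ba_mul a b *> x = a *> (b *> x).
Proof. exact: (bm_lactP X).2. Qed.
Lemma ractA X a b (x : X) : x <* ba_mul a b = x <* a <* b.
Proof. exact: (bm_ractP X).2. Qed.

Definition left_morphism X Y (f : X -> Y) : Prop :=
  bounded_linear f /\ forall a x, f (a *> x) = a *> f x.

Definition bimodule_morphism X Y (f : X -> Y) : Prop :=
  [/\ bounded_linear f, forall a x, f (a *> x) = a *> f x
    & forall x a, f (x <* a) = f x <* a].

Definition uone : Ap := (0, 1) : unitz A.
Definition uinj (a : A) : Ap := (a, 0) : unitz A.

Lemma unitz_split (x : Ap) : x = uinj x.1 + x.2 *: uone.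
Proof.
case: x => a k; apply: (@congr2 _ _ _ (fun a k => (a, k) : unitz A)) => /=.
  by rewrite scaler0 addr0.
by rewrite add0r -[RHS]/(k * 1) mulr1.
Qed.

Lemma unitz_mulE (x y : Ap) : ba_mul x y =
  (ba_mul x.1 y.1 + x.2 *: y.1 + y.2 *: x.1, x.2 * y.2) :> unitz A.
Proof. by []. Qed.

Lemma umul1 (x : Ap) : ba_mul uone x = x.
Proof.
rewrite unitz_mulE /= (bl0 (mulr_bl _)) add0r scale1r scaler0 addr0 mul1r.
by case: x.
Qed.

Lemma umulr1 (x : Ap) : ba_mul x uone = x.
Proof.
rewrite unitz_mulE /= (bl0 (mul_bl _)) add0r scale1r scaler0 add0r mulr1.
by case: x.
Qed.

Lemma uinj_bl : bounded_linear uinj.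
Proof.
apply: (@bounded_linear_le _ _ _ _ 1) => // [k x y|x].
  apply: (@congr2 _ _ _ (fun a k => (a, k) : unitz A)) => //.
  by rewrite -[RHS]/(k * 0 + 0) mulr0 addr0.
by rewrite unitz_normE /= normr0 addr0 mul1r.
Qed.

Lemma uinjM a b : uinj (ba_mul a b) = ba_mul (uinj a) (uinj b).
Proof. by rewrite unitz_mulE /= !scale0r !addr0 mulr0. Qed.

Definition ulact X (a : Ap) (x : X) : X := a.1 *> x + a.2 *: x.
Definition uract X (x : X) (a : Ap) : X := x <* a.1 + a.2 *: x.

Lemma unitz1D (x y : Ap) : (x + y).1 = x.1 + y.1. Proof. by []. Qed.
Lemma unitz2D (x y : Ap) : (x + y).2 = x.2 + y.2. Proof. by []. Qed.
Lemma unitz1Z k (x : Ap) : (k *: x).1 = k *: x.1. Proof. by []. Qed.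
Lemma unitz2Z k (x : Ap) : (k *: x).2 = k * x.2. Proof. by []. Qed.

Lemma uract_bilinear X : bilinear_map (@uract X).
Proof.
split=> [a k x y|x k a b]; rewrite /uract.
  by rewrite (ract_bl _ _).1 !scalerDr !scalerA mulrC addrACA.
rewrite unitz1D unitz2D unitz1Z unitz2Z (ract_bl_alg _).1.
by rewrite scalerDl scalerDr scalerA addrACA.
Qed.

Lemma ulact_bilinear X : bilinear_map (@ulact X).
Proof.
split=> [x k a b|a k x y]; rewrite /ulact.
  rewrite unitz1D unitz2D unitz1Z unitz2Z (lact_bl_alg _).1.
  by rewrite scalerDl scalerDr scalerA addrACA.
by rewrite (lact_bl _ _).1 !scalerDr !scalerA mulrC addrACA.
Qed.

Lemma uract_bounded X : bounded_bilinear (@uract X).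
Proof.
have [c c0 rc] := bounded_bilinear_bound (bm_ractP X).1.
apply: (@bounded_bilinear_le _ _ _ _ _ (c + 1)) => [||x a].
- exact: uract_bilinear.
- exact: addr_ge0.
rewrite (le_trans (ler_normD _ _))// normrZ unitz_normE -mulrA mulrDl mul1r.
rewrite lerD//.
  by rewrite (le_trans (rc _ _))// -!mulrA !ler_wpM2l// lerDl.
by rewrite mulrC ler_wpM2l// lerDr.
Qed.

Lemma ulact_bounded X : bounded_bilinear (@ulact X).
Proof.
have [c c0 rc] := bounded_bilinear_bound (bm_lactP X).1.
apply: (@bounded_bilinear_le _ _ _ _ _ (c + 1)) => [||a x].
- exact: ulact_bilinear.
- exact: addr_ge0.
rewrite (le_trans (ler_normD _ _))// normrZ unitz_normE -mulrA mulrDl mul1r.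
rewrite lerD//.
  by rewrite (le_trans (rc _ _))// -!mulrA !ler_wpM2l// ler_wpM2r// lerDl.
by rewrite ler_wpM2r// lerDr.
Qed.

Lemma ulact_bl X a : bounded_linear (@ulact X a).
Proof. exact: bounded_bilinearr (ulact_bounded X). Qed.
Lemma ulact_bl_alg X (x : X) : bounded_linear (fun a => ulact a x).
Proof. exact: bounded_bilinearr (bounded_bilinear_flip (ulact_bounded X)). Qed.
Lemma uract_bl X a : bounded_linear (fun x : X => uract x a).
Proof. exact: bounded_bilinearr (bounded_bilinear_flip (uract_bounded X)). Qed.
Lemma uract_bl_alg X (x : X) : bounded_linear (uract x).
Proof. exact: bounded_bilinearr (uract_bounded X). Qed.

Lemma ulact_inj X a (x : X) : ulact (uinj a) x = a *> x.
Proof. by rewrite /ulact /= scale0r addr0. Qed.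
Lemma uract_inj X a (x : X) : uract x (uinj a) = x <* a.
Proof. by rewrite /uract /= scale0r addr0. Qed.
Lemma ulact1 X (x : X) : ulact uone x = x.
Proof. by rewrite /ulact /= (bl0 (lact_bl_alg x)) add0r scale1r. Qed.
Lemma uract1 X (x : X) : uract x uone = x.
Proof. by rewrite /uract /= (bl0 (ract_bl_alg x)) add0r scale1r. Qed.

Lemma ulactA X (a b : Ap) (x : X) : ulact (ba_mul a b) x = ulact a (ulact b x).
Proof.
rewrite {1}/ulact unitz_mulE /= !(blD (lact_bl_alg x)) !(blZ (lact_bl_alg x)).
rewrite lactA /ulact (blD (lact_bl _ a.1)) (blZ (lact_bl _ a.1)) scalerDr.
by rewrite scalerA !addrA [RHS](ACl (1*3*2*4)).
Qed.

Lemma uractA X (x : X) (a b : Ap) : uract x (ba_mul a b) = uract (uract x a) b.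
Proof.
rewrite {1}/uract unitz_mulE /= !(blD (ract_bl_alg x)) !(blZ (ract_bl_alg x)).
rewrite ractA /uract (blD (ract_bl _ b.1)) (blZ (ract_bl _ b.1)) scalerDr.
by rewrite scalerA [b.2 * _]mulrC !addrA.
Qed.

Lemma ulactrA X (a : Ap) (x : X) (b : Ap) :
  uract (ulact a x) b = ulact a (uract x b).
Proof.
rewrite /uract /ulact (blD (ract_bl _ _)) (blZ (ract_bl _ _)) bm_actA.
rewrite (blD (lact_bl _ _)) (blZ (lact_bl _ _)) !scalerDr !scalerA.
by rewrite mulrC !addrA [RHS](ACl (1*3*2*4)).
Qed.

End Bimodules.

Section EnvelopingModules.
Context {R : realType} {A : banachAlgebra R}.
Local Notation C := R[i].
Local Notation Ap := (unitization A).
Variable Ae : enveloping_algebra A.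
Local Notation t := (@ta_tens _ _ _ Ae).
Implicit Types (X Y : bimodule A) (M N : lmodule Ae).

Definition ltens (a : A) : Ae := t (uinj a) (uone : Ap).
Definition rtens (a : A) : Ae := t (uone : Ap) (uinj a).
Definition one_tens : Ae := t (uone : Ap) (uone : Ap).

Let tb : bilinear_map t := let: And3 h _ _ := ta_tensP Ae in h.

Lemma tens_bounded : bounded_bilinear t.
Proof.
apply: (@bounded_bilinear_le _ _ _ _ _ 1) => //.
by have [_ tn _] := ta_tensP Ae => x y; rewrite mul1r tn.
Qed.

Lemma tensl_bl (y : Ap) : bounded_linear (fun x : Ap => t x y).
Proof. exact: bounded_bilinearr (bounded_bilinear_flip tens_bounded). Qed.
Lemma tensr_bl (x : Ap) : bounded_linear (fun y : Ap => t x y).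
Proof. exact: bounded_bilinearr tens_bounded. Qed.

Lemma tens_ext (W : completeNormedModType C) (g h : Ae -> W) :
  bounded_linear g -> bounded_linear h ->
  (forall x y : Ap, g (t x y) = h (t x y)) -> g =1 h.
Proof. by move=> bg bh gh u; rewrite (tensor_ext (ta_tensP Ae) bg bh gh). Qed.

Lemma tensM (x y x' y' : Ap) :
  ba_mul (t x y) (t x' y') = t (ba_mul x x') (ba_mul y' y).
Proof. exact: ta_mul. Qed.

Lemma tens_factor (x y : Ap) :
  t x y = ba_mul (t x (uone : Ap)) (t (uone : Ap) y).
Proof. by rewrite tensM umulr1 umulr1. Qed.

Lemma tens_l (x : Ap) : t x (uone : Ap) = ltens x.1 + x.2 *: one_tens.
Proof.
rewrite {1}[x]unitz_split (blD (tensl_bl _)) (blZ (tensl_bl _)).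
by [].
Qed.

Lemma tens_r (x : Ap) : t (uone : Ap) x = rtens x.1 + x.2 *: one_tens.
Proof.
rewrite {1}[x]unitz_split (blD (tensr_bl _)) (blZ (tensr_bl _)).
by [].
Qed.

Lemma one_tensM : ba_mul one_tens =1 id.
Proof.
apply: (tens_ext (mul_bl _) (bounded_linear_id _)) => x y.
by rewrite tensM umulr1 umul1.
Qed.

Lemma one_tensMr z : ba_mul z one_tens = z.
Proof.
move: z; apply: (tens_ext (mulr_bl _) (bounded_linear_id _)) => x y.
by rewrite tensM umulr1 umul1.
Qed.

Lemma lm_bl M b : bounded_linear (fun m : M => lm_act b m).
Proof. exact: bounded_bilinearr (lm_actP M).1. Qed.
Lemma lm_bl_alg M (m : M) : bounded_linear (fun b => lm_act b m).
Proof. exact: bounded_bilinearr (bounded_bilinear_flip (lm_actP M).1). Qed.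
Lemma lm_actA M a b (m : M) : lm_act (ba_mul a b) m = lm_act a (lm_act b m).
Proof. exact: (lm_actP M).2. Qed.

(** Each x ⊗ y factors as (x ⊗ 1)(1 ⊗ y), whose factors are combinations of [ltens], [rtens] and
    [one_tens], and a bounded linear map on [Ae] is determined by elementary tensors. The condition
    on [one_tens] is there because M and N may be non-unital. *)
Lemma module_morphismP M N (g : M -> N) : bounded_linear g ->
  (forall a m, g (lm_act (ltens a) m) = lm_act (ltens a) (g m)) ->
  (forall a m, g (lm_act (rtens a) m) = lm_act (rtens a) (g m)) ->
  (forall m, g (lm_act one_tens m) = lm_act one_tens (g m)) ->
  module_morphism g.
Proof.
move=> bg gl gr g1; split=> // b m; move: b.
apply: (tens_ext (bounded_linear_comp bg (lm_bl_alg m)) (lm_bl_alg _)) => x y.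
 rewrite tens_factor !lm_actA.
have {}gl z : g (lm_act (t x (uone : Ap)) z) = lm_act (t x (uone : Ap)) (g z).
  rewrite tens_l !(blD (lm_bl_alg _)) !(blZ (lm_bl_alg _)).
  by rewrite (blD bg) (blZ bg) gl g1.
rewrite gl tens_r !(blD (lm_bl_alg _)) !(blZ (lm_bl_alg _)).
by rewrite (blD bg) (blZ bg) gr g1.
Qed.

Definition und_lact M (a : A) (m : M) : M := lm_act (ltens a) m.
Definition und_ract M (m : M) (a : A) : M := lm_act (rtens a) m.

Lemma ltensM a b : ltens (ba_mul a b) = ba_mul (ltens a) (ltens b).
Proof. by rewrite /ltens tensM umulr1 uinjM. Qed.
Lemma rtensM a b : rtens (ba_mul a b) = ba_mul (rtens b) (rtens a).
Proof. by rewrite /rtens tensM umulr1 uinjM. Qed.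
Lemma lrtensC a b : ba_mul (ltens a) (rtens b) = ba_mul (rtens b) (ltens a).
Proof. by rewrite /ltens /rtens !tensM !umulr1 !umul1. Qed.
Lemma ltens_bl : bounded_linear ltens.
Proof. exact: bounded_linear_comp (tensl_bl _) uinj_bl. Qed.
Lemma rtens_bl : bounded_linear rtens.
Proof. exact: bounded_linear_comp (tensr_bl _) uinj_bl. Qed.

Lemma und_lactP M : is_left_action (@und_lact M).
Proof.
split=> [|a b x]; last by rewrite /und_lact ltensM lm_actA.
have [c c0 mc] := bounded_bilinear_bound (lm_actP M).1.
have [d d0 ld] := bounded_linear_bound ltens_bl.
apply: (@bounded_bilinear_le _ _ _ _ _ (c * d)) => [||a x].
- split=> [x k a b|a k x y]; rewrite /und_lact; last exact: (lm_bl _ _).1.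
  by rewrite ltens_bl.1 (lm_bl_alg x).1.
- exact: mulr_ge0.
by rewrite (le_trans (mc _ _))// ler_wpM2r// -mulrA ler_wpM2l.
Qed.

Lemma und_ractP M : is_right_action (@und_ract M).
Proof.
split=> [|x a b]; last by rewrite /und_ract rtensM lm_actA.
have [c c0 mc] := bounded_bilinear_bound (lm_actP M).1.
have [d d0 ld] := bounded_linear_bound rtens_bl.
apply: (@bounded_bilinear_le _ _ _ _ _ (c * d)) => [||x a].
- split=> [a k x y|x k a b]; rewrite /und_ract; first exact: (lm_bl _ _).1.
  by rewrite rtens_bl.1 (lm_bl_alg x).1.
- exact: mulr_ge0.
by rewrite (le_trans (mc _ _))// [leRHS]mulrAC ler_wpM2r// -mulrA ler_wpM2l.
Qed.

Lemma und_actA M (a : A) (m : M) (b : A) :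
  und_ract (und_lact a m) b = und_lact a (und_ract m b).
Proof. by rewrite /und_ract /und_lact -!lm_actA lrtensC. Qed.

(** The bimodule forgets how 1 ⊗ 1 acts; this has to be recorded separately whenever one returns to
    [Ae]-modules. *)
Definition und M : bimodule A :=
  Bimodule (@und_lactP M) (@und_ractP M) (@und_actA M).

Lemma und_one_lact M (m : und M) a : lm_act one_tens (a *> m : und M) = a *> m.
Proof. by rewrite /= /und_lact -lm_actA one_tensM. Qed.
Lemma und_one_ract M (m : und M) a : lm_act one_tens (m <* a : und M) = m <* a.
Proof. by rewrite /= /und_ract -lm_actA one_tensM. Qed.

(** 1 ⊗ 1 is the identity of [Ae], hence commutes with everything: the projection onto the unital
    part respects both actions. *)
Lemma und_one_morphism M :
  bimodule_morphism (fun m : und M => lm_act one_tens m : und M).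
Proof.
split=> [|a x|x a]; first exact: lm_bl.
  by rewrite /= /und_lact -!lm_actA one_tensM one_tensMr.
by rewrite /= /und_ract -!lm_actA one_tensM one_tensMr.
Qed.

Section Env.
Variable X : bimodule A.

Lemma env_bound : exists2 c : C, 0 <= c &
  forall (a b : Ap) (x : X), `|uract (ulact a x) b| <= c * `|x| * `|a| * `|b|.
Proof.
have [c c0 lc] := bounded_bilinear_bound (ulact_bounded X).
have [d d0 rd] := bounded_bilinear_bound (uract_bounded X).
exists (d * c) => [|a b x]; first exact: mulr_ge0.
rewrite (le_trans (rd _ _))// ler_wpM2r// -!mulrA ler_wpM2l//.
by rewrite (le_trans (lc _ _))// -mulrA [`|x| * _]mulrC.
Qed.

Let c := s2val (cid2 env_bound).
Let c0 : 0 <= c := s2valP (cid2 env_bound).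
Let cP := s2valP' (cid2 env_bound).

Lemma env_act_ex (x : X) : exists g : Ae -> X,
  [/\ linear g, forall u, `|g u| <= c * `|x| * `|u| &
      forall a b : Ap, g (t a b) = uract (ulact a x) b].
Proof.
have [_ _ ut] := ta_tensP Ae.
have [||a b|g [gP _]] := ut X (fun a b => uract (ulact a x) b) (c * `|x|).
- split=> [b k a a'|a k b b']; cbv beta; last exact: (uract_bl_alg _).1.
  by rewrite (ulact_bl_alg _).1 (uract_bl _ _).1.
- exact: mulr_ge0.
- exact: cP.
by exists g.
Qed.

Definition env_act (u : Ae) (x : X) : X := sval (cid (env_act_ex x)) u.

Lemma env_act_tens (a b : Ap) x : env_act (t a b) x = uract (ulact a x) b.
Proof. by rewrite /env_act; case: cid => g []. Qed.

Lemma env_act_bl_alg x : bounded_linear (env_act^~ x).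
Proof.
rewrite /env_act; case: cid => g [lg gb _] /=.
by apply: (@bounded_linear_le _ _ _ _ (c * `|x|)) => //; exact: mulr_ge0.
Qed.

Lemma env_act_norm u x : `|env_act u x| <= c * `|x| * `|u|.
Proof. by rewrite /env_act; case: cid => g []. Qed.

(** The universal property provides one map of u for each fixed x; linearity in x comes from its
    uniqueness clause. *)
Lemma env_act_bounded : bounded_bilinear env_act.
Proof.
apply: (@bounded_bilinear_le _ _ _ _ _ c) => // [|u x]; last first.
  by rewrite mulrAC env_act_norm.
split=> [x|u k x y]; first exact: (env_act_bl_alg x).1.
move: u; apply: tens_ext => [||a b]; first exact: env_act_bl_alg.
  by apply: bounded_linear_comb; exact: env_act_bl_alg.
by rewrite !env_act_tens (ulact_bl _ _).1 (uract_bl _ _).1.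
Qed.

Let env_act_bl u : bounded_linear (env_act u).
Proof. exact: bounded_bilinearr env_act_bounded. Qed.

Lemma env_actP : is_left_action env_act.
Proof.
split=> [|u v x]; first exact: env_act_bounded.
have step (a b : Ap) w :
    env_act (ba_mul w (t a b)) x = env_act w (env_act (t a b) x).
  move: w; apply: (tens_ext (bounded_linear_comp (env_act_bl_alg x) (mulr_bl _))
    (env_act_bl_alg _)) => a' b'.
  by rewrite tensM !env_act_tens ulactA uractA ulactrA.
move: v; apply: (tens_ext (bounded_linear_comp (env_act_bl_alg x) (mul_bl _))
  (bounded_linear_comp (env_act_bl u) (env_act_bl_alg x))) => a b.
exact: step.
Qed.

Definition env : lmodule Ae := LModule env_actP.

Lemma env_ltens a (x : env) : lm_act (ltens a) x = (a *> (x : X) : X).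
Proof. by rewrite /= env_act_tens uract1 ulact_inj. Qed.
Lemma env_rtens a (x : env) : lm_act (rtens a) x = ((x : X) <* a : X).
Proof. by rewrite /= env_act_tens ulact1 uract_inj. Qed.
Lemma env_one (x : env) : lm_act one_tens x = x.
Proof. by rewrite /= env_act_tens ulact1 uract1. Qed.

End Env.

(** Together with [morphism_env], this identifies module maps into [env X] with the bimodule maps on
    [und M] that see only the unital part of M. *)
Lemma env_morphismP M X (f : M -> X) :
  bimodule_morphism (f : und M -> X) ->
  (forall m, f (lm_act one_tens m) = f m) ->
  module_morphism (f : M -> env X).
Proof.
move=> [bf fl fr] f1; apply: module_morphismP => // [a m|a m|m].
- by rewrite [RHS]env_ltens -fl.
- by rewrite [RHS]env_rtens -fr.
- by rewrite [RHS]env_one f1.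
Qed.

Lemma env_env_morphism X Y (f : X -> Y) : bimodule_morphism f ->
  module_morphism (f : env X -> env Y).
Proof.
move=> [bf fl fr]; apply: env_morphismP => [|m]; last by rewrite env_one.
split=> // [a x|x a].
  by rewrite -[X in f X]/(lm_act (ltens a) (x : env X)) env_ltens fl.
by rewrite -[X in f X]/(lm_act (rtens a) (x : env X)) env_rtens fr.
Qed.

Lemma morphism_env M X (f : M -> X) : module_morphism (f : M -> env X) ->
  bimodule_morphism (f : und M -> X) /\ forall m, f (lm_act one_tens m) = f m.
Proof.
move=> [bf fb]; split=> [|m]; last by rewrite fb env_one.
split=> // [a x|x a]; first by rewrite [LHS]fb env_ltens.
by rewrite [LHS]fb env_rtens.
Qed.

Lemma und_morphism M N (f : M -> N) : module_morphism f ->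
  bimodule_morphism (f : und M -> und N).
Proof. by move=> [bf fb]; split=> // [a x|x a]; exact: fb. Qed.

End EnvelopingModules.

(** * Dimension shifting *)

Section BoundedOperators.
Context {R : realType}.
Local Notation C := R[i].
Variables (U V : completeNormedModType C).

Lemma small_eq0 (x : V) (c : C) : 0 <= c ->
  (forall e, 0 < e -> `|x| <= e * c) -> x = 0.
Proof.
move=> c0 xc; apply/eqP; rewrite -normr_le0; apply/ler_addgt0Pr => e e0.
have c1 : 0 < c + 1 by rewrite ltr_wpDl.
rewrite add0r (le_trans (xc _ (divr_gt0 e0 c1)))// mulrAC ler_pdivrMr//.
by rewrite ler_wpM2l ?ltW// ltrDl.
Qed.

Lemma linear_closed (f : U -> V) : (forall e : C, 0 < e -> exists2 g : U -> V,
  linear g & forall x, `|f x - g x| <= e * `|x|) -> linear f.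
Proof.
move=> fg k x y; apply/eqP; rewrite -subr_eq0; apply/eqP.
apply: (@small_eq0 _ (`|k *: x + y| + `|k| * `|x| + `|y|)) => [|e e0].
  by rewrite !addr_ge0// mulr_ge0.
have [g lg fge] := fg e e0.
have -> : f (k *: x + y) - (k *: f x + f y) =
    (f (k *: x + y) - g (k *: x + y)) - k *: (f x - g x) - (f y - g y).
  rewrite lg scalerBr !opprB !opprD !addrA.
  by rewrite [RHS](ACl (1*5*7*(2*4)*(3*6)))/= !addNr !addr0.
rewrite !mulrDr (le_trans (ler_normB _ _))// lerD// (le_trans (ler_normB _ _))//.
by rewrite lerD// normrZ mulrCA ler_wpM2l.
Qed.

Lemma lin_data_comb k (f g : U -> V) : linear f -> linear g ->
  linear (fun x => k *: f x + g x).
Proof. by move=> lf lg l x y; rewrite lf lg !scalerDr !scalerA mulrC addrACA. Qed.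

Lemma lin_data0 : linear (fun _ : U => 0 : V).
Proof. by move=> k x y; rewrite scaler0 addr0. Qed.

(** With the norm of U as weight, the norm of [bfun] is the operator norm. *)
Definition lin_data : bfun_data U V :=
  BfunData (@normr_ge0 _ _) lin_data0 lin_data_comb linear_closed.

Local Notation lmap := (bfun lin_data).

Definition mklmap (f : U -> V) : lmap := mkbfun lin_data f.

Lemma lmap_bl (f : lmap) : bounded_linear f.
Proof. by have [lf [c c0 fc]] := bfunP f; exact: bounded_linear_le lf c0 fc. Qed.

Lemma mklmapE f : bounded_linear f -> mklmap f = f :> (U -> V).
Proof.
move=> bf; apply: mkbfunE; split; first exact: bf.1.
by have [c c0 fc] := bounded_linear_bound bf; exists c.
Qed.

Lemma le_norm_lmap (f : lmap) x : `|f x| <= `|f| * `|x|.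
Proof. exact: le_norm_bfun. Qed.
Lemma norm_lmap_le (f : lmap) (c : C) : 0 <= c ->
  (forall x, `|f x| <= c * `|x|) -> `|f| <= c.
Proof. exact: norm_bfun_le. Qed.

Lemma mklmap_bl (X : normedModType C) (f : X -> U -> V) : bounded_bilinear f ->
  bounded_linear (fun x => mklmap (f x)).
Proof.
move=> bf; have [c c0 fc] := bounded_bilinear_bound bf.
apply: (@bounded_linear_le _ _ _ _ c) => // [k x y|x].
  apply: bfun_ext => u; rewrite bfunDE bfunZE !mklmapE ?bf.1.1//;
    exact: bounded_bilinearr bf.
apply: norm_lmap_le => [|u]; first exact: mulr_ge0.
by rewrite mklmapE//; exact: bounded_bilinearr bf.
Qed.

End BoundedOperators.

Local Notation lmap U V := (bfun (lin_data U V)).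

(** * The coinduced bimodule and its quotient by W *)

Section Shift.
Context {R : realType} {A : banachAlgebra R}.
Local Notation C := R[i].
Local Notation Ap := (unitization A).
Variable W : bimodule A.

Section LeftAction.
Variable U : completeNormedModType C.

Definition op_lact (a : A) (T : lmap U W) : lmap U W :=
  mklmap (fun x => a *> (T x : W) : W).

Lemma op_lactE a T x : op_lact a T x = a *> (T x : W).
Proof.
rewrite /op_lact mklmapE//.
exact: bounded_linear_comp (lact_bl _ _) (lmap_bl _).
Qed.

Lemma op_lactP : is_left_action op_lact.
Proof.
split=> [|a b T]; last by apply: bfun_ext => x; rewrite !op_lactE lactA.
have [c c0 lc] := bounded_bilinear_bound (bm_lactP W).1.
apply: (@bounded_bilinear_le _ _ _ _ _ c) => // [|a T].
  split=> [T k a b|a k T S]; apply: bfun_ext => x.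
    by rewrite bfunDE bfunZE !op_lactE (lact_bl_alg _).1.
  by rewrite bfunDE bfunZE !op_lactE (lact_bl _ _).1.
apply: norm_lmap_le => [|x]; first by rewrite !mulr_ge0.
rewrite op_lactE (le_trans (lc _ _))// -[leRHS]mulrA ler_wpM2l//.
  exact: mulr_ge0.
exact: le_norm_lmap.
Qed.

End LeftAction.

Definition coext_ract (F : lmap Ap W) (a : A) : lmap Ap W :=
  mklmap (fun x : Ap => F (ba_mul (uinj a) x)).

Lemma coext_ractE F a x : coext_ract F a x = F (ba_mul (uinj a) x).
Proof.
rewrite /coext_ract mklmapE//.
exact: bounded_linear_comp (lmap_bl _) (mul_bl _).
Qed.

Lemma coext_ractP : is_right_action coext_ract.
Proof.
split=> [|F a b]; last first.
  by apply: bfun_ext => x; rewrite !coext_ractE uinjM ba_mulA.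
apply: (@bounded_bilinear_le _ _ _ _ _ 1) => // [|F a].
  split=> [a k F G|F k a b]; apply: bfun_ext => x.
    by rewrite bfunDE bfunZE !coext_ractE.
  by rewrite bfunDE bfunZE !coext_ractE uinj_bl.1 (mulr_bl _).1 (lmap_bl F).1.
apply: norm_lmap_le => [|x]; first by rewrite !mulr_ge0.
rewrite coext_ractE (le_trans (le_norm_lmap _ _))// mul1r -mulrA ler_wpM2l//.
by rewrite (le_trans (ba_norm_mul _ _))// unitz_normE /= normr0 addr0.
Qed.

Lemma coext_actA a F b : coext_ract (op_lact a F) b = op_lact a (coext_ract F b).
Proof. by apply: bfun_ext => x; rewrite !(coext_ractE, op_lactE). Qed.

(* The bimodule of operators A_+ -> W is coinduced from the left module W. *)
Definition coext : bimodule A :=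
  Bimodule (@op_lactP Ap) coext_ractP coext_actA.

(** Every class of [coext] modulo W has one representative vanishing at 1, namely [coext_sect T].
    Acting by a turns it into an operator with value T a at 1; subtracting x |-> (T a) x restores
    the normalization. *)
Definition shift_ract (T : lmap A W) (a : A) : lmap A W :=
  mklmap (fun x => T (ba_mul a x) - (T a : W) <* x).

Lemma shift_ractE T a x : shift_ract T a x = T (ba_mul a x) - (T a : W) <* x.
Proof.
rewrite /shift_ract mklmapE//; apply: bounded_linearB.
  exact: bounded_linear_comp (lmap_bl _) (mul_bl _).
exact: ract_bl_alg.
Qed.

Lemma shift_ractP : is_right_action shift_ract.
Proof.
split=> [|T a b]; last first.
  apply: bfun_ext => x; rewrite !shift_ractE ba_mulA ractA (blB (ract_bl _ _)).
  by rewrite opprB addrA subrK.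
have [c c0 rc] := bounded_bilinear_bound (bm_ractP W).1.
apply: (@bounded_bilinear_le _ _ _ _ _ (1 + c)) => [||T a].
- split=> [a k T S|T k a b]; apply: bfun_ext => x.
    rewrite bfunDE bfunZE !shift_ractE !bfunDE !bfunZE (ract_bl _ _).1.
    by rewrite scalerBr opprD addrACA.
  rewrite bfunDE bfunZE !shift_ractE (mulr_bl _).1 !(lmap_bl T).1.
  by rewrite (ract_bl _ _).1 scalerBr opprD addrACA.
- exact: addr_ge0.
apply: norm_lmap_le => [|x]; first by rewrite !mulr_ge0// addr_ge0.
rewrite shift_ractE (le_trans (ler_normB _ _))// !mulrDl mul1r lerD//.
  rewrite (le_trans (le_norm_lmap _ _))// -mulrA ler_wpM2l//.
  exact: ba_norm_mul.
rewrite (le_trans (rc _ _))// ler_wpM2r// -mulrA ler_wpM2l//.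
exact: le_norm_lmap.
Qed.

Lemma shift_actA a T b : shift_ract (op_lact a T) b = op_lact a (shift_ract T b).
Proof.
apply: bfun_ext => x; rewrite !(shift_ractE, op_lactE).
by rewrite bm_actA (blB (lact_bl _ _)).
Qed.

(* The quotient of coext by the copy of W given by w |-> (x |-> w . x), so that
   H^(n+1)(A, W) = H^n(A, shift). *)
Definition shift : bimodule A :=
  Bimodule (@op_lactP A) shift_ractP shift_actA.

Lemma shiftDE (T S : shift) x :
  ((T + S : shift) : lmap A W) x = (T : lmap A W) x + (S : lmap A W) x.
Proof. by []. Qed.
Lemma shiftBE (T S : shift) x :
  ((T - S : shift) : lmap A W) x = (T : lmap A W) x - (S : lmap A W) x.
Proof. by []. Qed.
Lemma shiftZE k (T : shift) x :
  ((k *: T : shift) : lmap A W) x = k *: (T : lmap A W) x.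
Proof. by []. Qed.
Lemma shift_sumE I (r : seq I) (F : I -> shift) x :
  ((\sum_(i <- r) F i : shift) : lmap A W) x = \sum_(i <- r) (F i : lmap A W) x.
Proof. exact: bfun_sumE. Qed.

Definition coext_proj (F : coext) : shift :=
  mklmap (fun x => (F : lmap Ap W) (uinj x)
                   - ((F : lmap Ap W) (uone : Ap) : W) <* x).
Definition coext_sect (T : shift) : coext :=
  mklmap (fun x : Ap => (T : lmap A W) x.1).
Definition coext_val (F : coext) : W := (F : lmap Ap W) (uone : Ap).

Let proj_bl (F : coext) : bounded_linear (fun x => (F : lmap Ap W) (uinj x)
                   - ((F : lmap Ap W) (uone : Ap) : W) <* x).
Proof.
apply: bounded_linearB; last exact: ract_bl_alg.
exact: bounded_linear_comp (lmap_bl _) uinj_bl.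
Qed.

Lemma coext_projE (F : coext) x : (coext_proj F : lmap A W) x =
  (F : lmap Ap W) (uinj x) - coext_val F <* x.
Proof. by rewrite /coext_proj mklmapE. Qed.

Lemma unitz_fst_bl : bounded_linear (fun x : Ap => x.1).
Proof.
apply: (@bounded_linear_le _ _ _ _ 1) => // x.
by rewrite mul1r unitz_normE lerDl.
Qed.

Lemma coext_sectE (T : shift) x :
  (coext_sect T : lmap Ap W) x = (T : lmap A W) x.1.
Proof.
rewrite /coext_sect mklmapE//.
exact: bounded_linear_comp (lmap_bl _) unitz_fst_bl.
Qed.

Lemma coext_proj_bl : bounded_linear coext_proj.
Proof.
have [c c0 rc] := bounded_bilinear_bound (bm_ractP W).1.
have n1 : `|uone : Ap| = 1 by rewrite unitz_normE /= normr0 add0r normr1.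
apply: mklmap_bl; apply: (@bounded_bilinear_le _ _ _ _ _ (1 + c)) => [||F x].
- split=> [x k F G|F]; last exact: (proj_bl F).1.
  rewrite !bfunDE !bfunZE (ract_bl _ _).1.
  by rewrite scalerBr opprD addrACA.
- exact: addr_ge0.
rewrite (le_trans (ler_normB _ _))// !mulrDl mul1r lerD//.
  by rewrite (le_trans (le_norm_lmap _ _))// unitz_normE /= normr0 addr0.
rewrite (le_trans (rc _ _))// ler_wpM2r// ler_wpM2l//.
by rewrite (le_trans (le_norm_lmap _ _))// n1 mulr1.
Qed.

Lemma coext_proj_morphism : bimodule_morphism coext_proj.
Proof.
split=> [|a F|F a]; first exact: coext_proj_bl.
  apply: bfun_ext => x; rewrite /= op_lactE !coext_projE /coext_val !op_lactE.
  by rewrite bm_actA (blB (lact_bl _ _)).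
apply: bfun_ext => x; rewrite /= shift_ractE !coext_projE /coext_val.
rewrite !coext_ractE.
by rewrite umulr1 -uinjM (blB (ract_bl _ _)) opprB ractA addrA subrK.
Qed.

Lemma coext_sect_bl : bounded_linear coext_sect.
Proof.
apply: mklmap_bl; apply: (@bounded_bilinear_le _ _ _ _ _ 1) => // [|T x].
  split=> [//|T k x y]; exact: (lmap_bl T).1.
rewrite (le_trans (le_norm_lmap _ _))// mul1r ler_wpM2l//.
by rewrite unitz_normE lerDl.
Qed.

Lemma coext_sectK T : coext_proj (coext_sect T) = T.
Proof.
apply: bfun_ext => x; rewrite coext_projE /coext_val !coext_sectE /=.
by rewrite (bl0 (lmap_bl T)) (bl0 (ract_bl _ _)) subr0.
Qed.

Lemma coext_val_bl : bounded_linear coext_val.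
Proof. exact: bounded_linear_eval. Qed.

Lemma coext_val_lact a F : coext_val (a *> F) = a *> coext_val F.
Proof. by rewrite /coext_val op_lactE. Qed.

(** The defect of evaluation at 1 as a right module map is exactly the projection to [shift]. Both
    directions of the comparison below rest on this identity. *)
Lemma coext_val_ract F a :
  coext_val (F <* a) = (coext_proj F : lmap A W) a + coext_val F <* a.
Proof. by rewrite coext_projE subrK /coext_val coext_ractE umulr1. Qed.

End Shift.

(** * Hochschild cochains *)

Section Sequences.
Variable T : Type.

Definition snoc n (a : 'I_n -> T) (x : T) (i : 'I_n.+1) : T :=
  if unlift ord_max i is Some j then a j else x.

Definition init n (a : 'I_n.+1 -> T) (i : 'I_n) : T :=
  a (widen_ord (leqnSn n) i).

Lemma widen_lift n (i : 'I_n) : widen_ord (leqnSn n) i = lift ord_max i.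
Proof. by apply: val_inj; rewrite /= /bump leqNgt ltn_ord. Qed.

Lemma snoc_max n (a : 'I_n -> T) x : snoc a x ord_max = x.
Proof. by rewrite /snoc unlift_none. Qed.

Lemma snoc_ord0 (a : 'I_0 -> T) x : snoc a x ord0 = x.
Proof. by rewrite -[RHS](snoc_max a); congr snoc; apply: val_inj. Qed.

Lemma snoc_widen n (a : 'I_n -> T) x i :
  snoc a x (widen_ord (leqnSn n) i) = a i.
Proof. by rewrite /snoc widen_lift liftK. Qed.

Lemma eq_snoc n (f g : 'I_n.+1 -> T) :
  (forall i, f (widen_ord (leqnSn n) i) = g (widen_ord (leqnSn n) i)) ->
  f ord_max = g ord_max -> f = g.
Proof.
move=> fg fg1; apply/funext => i; case: (unliftP ord_max i) => [j|] -> //.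
by rewrite -widen_lift.
Qed.

Lemma init_snoc n (a : 'I_n -> T) x : init (snoc a x) = a.
Proof. by apply/funext => i; rewrite /init snoc_widen. Qed.

Lemma snoc_init n (a : 'I_n.+1 -> T) : snoc (init a) (a ord_max) = a.
Proof. by apply: eq_snoc => [i|]; rewrite (snoc_widen, snoc_max). Qed.

Lemma neq_widen_max n (i : 'I_n) : (widen_ord (leqnSn n) i == ord_max) = false.
Proof. by rewrite widen_lift eq_sym (negbTE (neq_lift _ _)). Qed.

Lemma eq_widen n (i j : 'I_n) :
  (widen_ord (leqnSn n) i == widen_ord (leqnSn n) j) = (i == j).
Proof. by []. Qed.

Lemma snoc_with n (a : 'I_n -> T) x i y :
  [eta snoc a x with widen_ord (leqnSn n) i |-> y] =
  snoc [eta a with i |-> y] x :> ('I_n.+1 -> T).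
Proof.
apply: eq_snoc => [j|] /=; first by rewrite !snoc_widen eq_widen.
by rewrite eq_sym neq_widen_max !snoc_max.
Qed.

Lemma snoc_with_max n (a : 'I_n -> T) x y :
  [eta snoc a x with ord_max |-> y] = snoc a y :> ('I_n.+1 -> T).
Proof.
apply: eq_snoc => [j|] /=; first by rewrite neq_widen_max !snoc_widen.
by rewrite eqxx snoc_max.
Qed.

Lemma ord0_fun (a b : 'I_0 -> T) : a = b.
Proof. by apply/funext => -[]. Qed.

End Sequences.

Section Cochains.
Context {R : realType} {A : banachAlgebra R}.
Local Notation C := R[i].

Section Basics.
Variable W : bimodule A.
Implicit Types X Y : bimodule A.

(** The bound M in the definition is an arbitrary complex number; its modulus is a nonnegative
    constant that serves equally well. *)
Lemma cochain_bound n (f : ('I_n -> A) -> W) : hochschild_cochain f ->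
  exists2 c : C, 0 <= c & forall a, `|f a| <= c * \prod_(i < n) `|a i|.
Proof.
move=> [_ [M fM]]; exists `|M| => // a.
have p0 : 0 <= \prod_(i < n) `|a i| by rewrite prodr_ge0.
by rewrite -[X in _ * X]ger0_norm// -normrM ger0_norm// (le_trans _ (fM a)).
Qed.

Lemma cochain_lin n (f : ('I_n -> A) -> W) a i k x y : hochschild_cochain f ->
  f [eta a with i |-> k *: x + y] =
  k *: f [eta a with i |-> x] + f [eta a with i |-> y].
Proof. by move=> [lf _]; exact: lf. Qed.

Lemma cochain_comb n k (f g : ('I_n -> A) -> W) :
  hochschild_cochain f -> hochschild_cochain g ->
  hochschild_cochain (fun a => k *: f a + g a).
Proof.
move=> hf hg; split=> [a i l x y|].
  by rewrite hf.1 hg.1 !scalerDr !scalerA mulrC addrACA.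
have [c c0 fc] := cochain_bound hf; have [d d0 gd] := cochain_bound hg.
exists (`|k| * c + d) => a; rewrite (le_trans (ler_normD _ _))// mulrDl lerD//.
by rewrite normrZ -mulrA ler_wpM2l.
Qed.

Lemma cochain0 n : hochschild_cochain (fun _ : 'I_n -> A => 0 : W).
Proof.
split=> [a i k x y|]; first by rewrite scaler0 addr0.
by exists 0 => a; rewrite normr0 mul0r.
Qed.

Lemma cochainZ n k (f : ('I_n -> A) -> W) :
  hochschild_cochain f -> hochschild_cochain (fun a => k *: f a).
Proof.
move=> hf; have := cochain_comb k hf (cochain0 n).
by congr hochschild_cochain; apply/funext => a; rewrite addr0.
Qed.

Lemma cochainB n (f g : ('I_n -> A) -> W) :
  hochschild_cochain f -> hochschild_cochain g ->
  hochschild_cochain (fun a => f a - g a).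
Proof.
move=> hf hg; have := cochain_comb (-1) hg hf.
by congr hochschild_cochain; apply/funext => a; rewrite scaleN1r addrC.
Qed.

Lemma hochschild_d_comb n k (f g : ('I_n -> A) -> W) a :
  hochschild_d (fun a => k *: f a + g a) a =
  k *: hochschild_d f a + hochschild_d g a.
Proof.
rewrite /hochschild_d (lact_bl _ _).1 (ract_bl _ _).1 !scalerDr.
rewrite scaler_sumr !scalerA [_ * k]mulrC.
under eq_bigr do rewrite scalerDr scalerA mulrC -scalerA.
rewrite big_split /= !addrA; congr (_ + _).
by rewrite [LHS](ACl (1*3*5*2*4))/=.
Qed.

Lemma hochschild_dZ n k (f : ('I_n -> A) -> W) a :
  hochschild_d (fun a => k *: f a) a = k *: hochschild_d f a.
Proof.
rewrite /hochschild_d (blZ (lact_bl _ _)) (blZ (ract_bl _ _)) !scalerDr.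
rewrite scaler_sumr !scalerA [_ * k]mulrC.
by under eq_bigr do rewrite scalerA mulrC -scalerA.
Qed.

Lemma hochschild_dB n (f g : ('I_n -> A) -> W) a :
  hochschild_d (fun a => f a - g a) a = hochschild_d f a - hochschild_d g a.
Proof.
rewrite addrC -scaleN1r -hochschild_d_comb; congr hochschild_d.
by apply/funext => b; rewrite scaleN1r addrC.
Qed.

Lemma hochschild_d0 (f : ('I_0 -> A) -> W) a b :
  hochschild_d f a = a ord0 *> f b - f b <* a ord0.
Proof.
rewrite /hochschild_d big_ord0 addr0 expr1 scaleN1r.
rewrite (ord0_fun (fun i => a (lift ord0 i)) b).
rewrite (ord0_fun (fun i => a (widen_ord _ i)) b).
by have -> : ord_max = ord0 :> 'I_1 by apply: val_inj.
Qed.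

Lemma cochain_0 (f : ('I_0 -> A) -> W) : hochschild_cochain f.
Proof.
split=> [a []//|]; exists `|f (fun=> 0)| => a.
by rewrite big_ord0 mulr1 (ord0_fun a (fun=> 0)).
Qed.

Lemma cochain_comp X n (f : ('I_n -> A) -> W) (q : W -> X) :
  bounded_linear q -> hochschild_cochain f ->
  hochschild_cochain (fun a => q (f a)).
Proof.
move=> bq hf; split=> [a i k x y|]; first by rewrite hf.1 bq.1.
have [c c0 fc] := cochain_bound hf; have [d d0 qd] := bounded_linear_bound bq.
by exists (d * c) => a; rewrite (le_trans (qd _))// -mulrA ler_wpM2l.
Qed.

Lemma hochschild_d_comp X n (f : ('I_n -> A) -> W) (q : W -> X) a :
  bimodule_morphism q ->
  hochschild_d (fun a => q (f a)) a = q (hochschild_d f a).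
Proof.
move=> [bq ql qr]; rewrite /hochschild_d !(blD bq) (bl_sum bq) ql.
rewrite (blZ bq) qr; congr (_ + _ + _).
by apply: eq_bigr => k _; rewrite (blZ bq).
Qed.

End Basics.

(** * Currying cochains in the last variable *)

Section Currying.
Variable W : bimodule A.

Definition curry n (f : ('I_n.+1 -> A) -> W) (a : 'I_n -> A) : shift W :=
  mklmap (fun x => f (snoc a x)).

Definition uncurry n (f : ('I_n -> A) -> shift W) (a : 'I_n.+1 -> A) : W :=
  (f (init a) : lmap A W) (a ord_max).

Lemma snoc_bl n (f : ('I_n.+1 -> A) -> W) a : hochschild_cochain f ->
  bounded_linear (fun x => f (snoc a x)).
Proof.
move=> hf; have [c c0 fc] := cochain_bound hf.
apply: (@bounded_linear_le _ _ _ _ (c * \prod_(i < n) `|a i|)) => [k x y||x].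
- rewrite -(snoc_with_max a 0 x) -(snoc_with_max a 0 y).
  by rewrite -(snoc_with_max a 0 (k *: x + y)) cochain_lin.
- by rewrite mulr_ge0// prodr_ge0.
rewrite (le_trans (fc _))// big_ord_recr /= snoc_max mulrA.
by under eq_bigr do rewrite snoc_widen.
Qed.

Lemma curryE n (f : ('I_n.+1 -> A) -> W) a x : hochschild_cochain f ->
  (curry f a : lmap A W) x = f (snoc a x).
Proof. by move=> hf; rewrite /curry mklmapE//; exact: snoc_bl. Qed.

Lemma curryK n (f : ('I_n.+1 -> A) -> W) : hochschild_cochain f ->
  uncurry (curry f) = f.
Proof. by move=> hf; apply/funext => a; rewrite /uncurry curryE// snoc_init. Qed.

Lemma uncurryK n (f : ('I_n -> A) -> shift W) :
  hochschild_cochain (uncurry f) ->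
  curry (uncurry f) = f.
Proof.
move=> hf; apply/funext => a; apply: bfun_ext => x.
by rewrite [LHS]curryE// /uncurry snoc_max init_snoc.
Qed.

Lemma cochain_curry n (f : ('I_n.+1 -> A) -> W) :
  hochschild_cochain f -> hochschild_cochain (curry f).
Proof.
move=> hf; split=> [a i k x y|].
  by apply: bfun_ext => z; rewrite bfunDE bfunZE !curryE// -!snoc_with hf.1.
have [c c0 fc] := cochain_bound hf; exists c => a.
apply: norm_lmap_le => [|x]; first by rewrite mulr_ge0// prodr_ge0.
rewrite curryE// (le_trans (fc _))// big_ord_recr /= snoc_max mulrA.
by under eq_bigr do rewrite snoc_widen.
Qed.

Lemma cochain_uncurry n (f : ('I_n -> A) -> shift W) :
  hochschild_cochain f -> hochschild_cochain (uncurry f).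
Proof.
move=> hf; split=> [a i|].
  rewrite -[a]snoc_init; move: (init a) (a ord_max) => {}a z k x y.
  case: (unliftP ord_max i) => [j|] ->.
    by rewrite -widen_lift !snoc_with /uncurry !snoc_max !init_snoc hf.1.
  by rewrite !snoc_with_max /uncurry !snoc_max !init_snoc (lmap_bl _).1.
have [c c0 fc] := cochain_bound hf; exists c => a.
by rewrite (le_trans (le_norm_lmap _ _))// big_ord_recr /= mulrA ler_wpM2r//.
Qed.

Lemma contract_snoc n (k : 'I_n) (a : 'I_n.+1 -> A) x :
  Defs.contract (widen_ord (leqnSn n) k) (snoc a x) =
  snoc (Defs.contract k a) x.
Proof.
apply: eq_snoc => [i|].
  rewrite snoc_widen /Defs.contract /= eq_widen !snoc_widen.
  have -> : lift ord0 (widen_ord (leqnSn n) i) =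
      widen_ord (leqnSn n.+1) (lift ord0 i).
    exact: val_inj.
  by rewrite snoc_widen.
rewrite snoc_max /Defs.contract /= ltnNge ltnW//= eq_sym neq_widen_max.
have -> : lift ord0 (ord_max : 'I_n.+1) = ord_max by apply: val_inj.
by rewrite snoc_max.
Qed.

Lemma contract_snoc_max n (a : 'I_n.+1 -> A) x :
  Defs.contract (@ord_max n) (snoc a x) = snoc (init a) (ba_mul (a ord_max) x).
Proof.
apply: eq_snoc => [i|].
  by rewrite snoc_widen /Defs.contract /= ltn_ord !snoc_widen.
rewrite snoc_max /Defs.contract /= ltnn eqxx !snoc_widen.
have -> : lift ord0 (ord_max : 'I_n.+1) = ord_max by apply: val_inj.
by rewrite snoc_max.
Qed.

(** The last two terms of the differential, f(..., a x) and f(..., a) x, occur with opposite signs,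
    and together they form the right action of [shift]; the other terms correspond one to one. *)
Lemma hochschild_d_curry n (f : ('I_n.+1 -> A) -> W) a x : hochschild_cochain f ->
  (hochschild_d (curry f) a : lmap A W) x = hochschild_d f (snoc a x).
Proof.
move=> hf; rewrite /hochschild_d.
have -> : \sum_(k < n.+1) (-1) ^+ k.+1 *: f (Defs.contract k (snoc a x)) =
    \sum_(k < n) (-1) ^+ k.+1 *: f (snoc (Defs.contract k a) x) +
    (-1) ^+ n.+1 *: f (snoc (init a) (ba_mul (a ord_max) x)).
  rewrite big_ord_recr /= contract_snoc_max.
  by under eq_bigr do rewrite contract_snoc.
rewrite !shiftDE shift_sumE shiftZE op_lactE shift_ractE !curryE//.
rewrite snoc_max.
have -> : snoc a x ord0 = a ord0.
  by rewrite -[RHS](snoc_widen _ x); congr snoc; apply: val_inj.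
have -> : (fun i => snoc a x (lift ord0 i)) = snoc (fun i => a (lift ord0 i)) x.
  apply: eq_snoc => [i|]; last first.
    have -> : lift ord0 (ord_max : 'I_n.+1) = ord_max by apply: val_inj.
    by rewrite !snoc_max.
  rewrite [RHS]snoc_widen -[RHS](snoc_widen _ x); congr snoc.
  exact: val_inj.
under eq_bigr do rewrite shiftZE curryE//.
rewrite -[fun i => snoc a x _]/(init (snoc a x)) init_snoc.
rewrite -[fun i => a (widen_ord _ i)]/(init a) snoc_init.
by rewrite scalerBr [(-1) ^+ n.+2]exprS mulN1r scaleNr !addrA.
Qed.

Lemma hochschild_d_uncurry n (f : ('I_n -> A) -> shift W) :
  hochschild_cochain f -> hochschild_d (uncurry f) = uncurry (hochschild_d f).
Proof.
move=> hf; have hu := cochain_uncurry hf.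
by apply/funext => a; rewrite -{1}[a]snoc_init -hochschild_d_curry// uncurryK.
Qed.

End Currying.

(** Currying lowers the degree at the price of replacing W by [shift W], so no estimate of the
    alternating sum is required: only degree 0 remains, where the differential is an inner
    derivation. *)
Lemma cochain_d n (W : bimodule A) (f : ('I_n -> A) -> W) :
  hochschild_cochain f -> hochschild_cochain (hochschild_d f).
Proof.
elim: n W f => [|n IHn] W f hf.
  have -> : hochschild_d f =
      uncurry (fun=> mklmap (fun x => x *> f (fun=> 0) - f (fun=> 0) <* x)).
    apply/funext => a; rewrite (hochschild_d0 _ _ (fun=> 0)) /uncurry mklmapE.
      by have -> : ord_max = ord0 :> 'I_1 by apply: val_inj.
    by apply: bounded_linearB; [exact: lact_bl_alg|exact: ract_bl_alg].
  by apply: cochain_uncurry; exact: cochain_0.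
rewrite -[f]curryK// hochschild_d_uncurry; last exact: cochain_curry.
by apply: cochain_uncurry; apply: IHn; exact: cochain_curry.
Qed.

(** The same induction takes the place of the cancellation of contractions; its base says that inner
    derivations are derivations. *)
Lemma hochschild_dd n (W : bimodule A) (f : ('I_n -> A) -> W) a :
  hochschild_cochain f -> hochschild_d (hochschild_d f) a = 0.
Proof.
elim: n W f a => [|n IHn] W f a hf; last first.
  have hc := cochain_curry hf.
  rewrite -[f]curryK// hochschild_d_uncurry// hochschild_d_uncurry.
    by rewrite /uncurry IHn// bfun0E.
  exact: cochain_d.
have hd := cochain_d hf.
rewrite -[a]snoc_init -hochschild_d_curry// (hochschild_d0 _ _ (fun=> 0)).
rewrite shiftBE shift_ractE op_lactE !curryE//.
rewrite !(hochschild_d0 _ _ (fun=> 0)).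
rewrite !snoc_ord0 (blB (lact_bl _ _)) (blB (ract_bl _ _)) lactA ractA bm_actA.
by rewrite !opprB !addrA subrK subrK subrr.
Qed.

(* Evaluation coext W -> W is a left morphism only; its failure to commute with
   the differential is measured by the quotient shift W. *)
Lemma hochschild_d_coext_val n (W : bimodule A) (f : ('I_n -> A) -> coext W) a :
  coext_val (hochschild_d f a) =
  hochschild_d (fun b => coext_val (f b)) a +
  (-1) ^+ n.+1 *: uncurry (fun b => coext_proj (f b)) a.
Proof.
have bv := coext_val_bl W.
rewrite /hochschild_d !(blD bv) (bl_sum bv) coext_val_lact (blZ bv).
rewrite coext_val_ract scalerDr -!addrA; congr (_ + _).
by rewrite [_ *: _ + _]addrC !addrA.
Qed.

End Cochains.

(** * Closed subspaces and lifting of left module maps *)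

Section FixedSpace.
Context {R : realType}.
Local Notation C := R[i].
Variables (V : completeNormedModType C) (Q : V -> V).
Hypothesis bQ : bounded_linear Q.

Let fix_pred (f : unit -> V) : Prop := Q (f tt) = f tt.

Let fix0 : fix_pred (fun=> 0).
Proof. exact: bl0 bQ. Qed.

Let fix_lin k f g : fix_pred f -> fix_pred g ->
  fix_pred (fun s => k *: f s + g s).
Proof. by move=> ff fg; rewrite /fix_pred bQ.1 ff fg. Qed.

Let fix_closed f : (forall e : C, 0 < e -> exists2 g, fix_pred g &
  forall s, `|f s - g s| <= e * (fun=> 1) s) -> fix_pred f.
Proof.
move=> fg; apply/eqP; rewrite -subr_eq0; apply/eqP.
have [c c0 Qc] := bounded_linear_bound bQ.
apply: (@small_eq0 _ _ _ (c + 1)) => [|e e0]; first exact: addr_ge0.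
have [g gQ /(_ tt)] := fg e e0; rewrite mulr1 => fge.
have -> : Q (f tt) - f tt = Q (f tt - g tt) - (f tt - g tt).
  by rewrite (blB bQ) gQ opprB addrA subrK.
rewrite (le_trans (ler_normB _ _))// mulrDr mulr1 lerD//.
by rewrite (le_trans (Qc _))// mulrC ler_wpM2r.
Qed.

Definition fix_data : bfun_data unit V :=
  BfunData (fun=> ler01) fix0 fix_lin fix_closed.

Local Notation F := (bfun fix_data).

Definition fix_val (x : F) : V := x tt.
Definition fix_mk (x : V) : F := mkbfun fix_data (fun=> x).

Lemma fix_valP x : Q (fix_val x) = fix_val x.
Proof. exact: (bfunP x).1. Qed.

Lemma fix_mkK x : Q x = x -> fix_val (fix_mk x) = x.
Proof.
move=> Qx; rewrite /fix_val /fix_mk mkbfunE//; split=> //.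
by exists `|x| => // s; rewrite mulr1.
Qed.

Lemma fix_val_inj : injective fix_val.
Proof. by move=> x y xy; apply: bfun_ext => -[]. Qed.

Lemma fix_val_bl : bounded_linear fix_val.
Proof. exact: bounded_linear_eval. Qed.

Lemma fix_norm x : `|x| = `|fix_val x|.
Proof.
apply/eqP; rewrite eq_le; apply/andP; split.
  by apply: norm_bfun_le => // -[]; rewrite mulr1.
by rewrite (le_trans (le_norm_bfun _ _))// mulr1.
Qed.

Lemma fix_mk_bl (U : normedModType C) (f : U -> V) : bounded_linear f ->
  (forall x, Q (f x) = f x) -> bounded_linear (fun x => fix_mk (f x)).
Proof.
move=> bf fQ; have [c c0 fc] := bounded_linear_bound bf.
apply: (@bounded_linear_le _ _ _ _ c) => // [k x y|x].
  by apply: fix_val_inj; rewrite fix_val_bl.1 !fix_mkK// bf.1.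
by rewrite fix_norm fix_mkK.
Qed.

End FixedSpace.

Section FixedBimodule.
Context {R : realType} {A : banachAlgebra R}.
Variables (X : bimodule A) (Q : X -> X).
Hypothesis bQ : bounded_linear Q.
Hypothesis Ql : forall a x, Q x = x -> Q (a *> x) = a *> x.
Hypothesis Qr : forall x a, Q x = x -> Q (x <* a) = x <* a.
Local Notation F := (bfun (fix_data bQ)).

Let lact (a : A) (x : F) : F := fix_mk bQ (a *> (fix_val x : X) : X).
Let ract (x : F) (a : A) : F := fix_mk bQ ((fix_val x : X) <* a : X).

Let lactE a x : fix_val (lact a x) = a *> (fix_val x : X).
Proof. by rewrite fix_mkK//; apply: Ql; exact: fix_valP. Qed.
Let ractE x a : fix_val (ract x a) = (fix_val x : X) <* a.
Proof. by rewrite fix_mkK//; apply: Qr; exact: fix_valP. Qed.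

Let lactP : is_left_action lact.
Proof.
split=> [|a b x]; last by apply: fix_val_inj; rewrite !lactE lactA.
have [c c0 lc] := bounded_bilinear_bound (bm_lactP X).1.
apply: (@bounded_bilinear_le _ _ _ _ _ c) => // [|a x].
  split=> [x k a b|a k x y]; apply: fix_val_inj.
    by rewrite (fix_val_bl _).1 !lactE (lact_bl_alg _).1.
  by rewrite (fix_val_bl _).1 !lactE (fix_val_bl _).1 (lact_bl _ _).1.
by rewrite !fix_norm lactE.
Qed.

Let ractP : is_right_action ract.
Proof.
split=> [|x a b]; last by apply: fix_val_inj; rewrite !ractE ractA.
have [c c0 lc] := bounded_bilinear_bound (bm_ractP X).1.
apply: (@bounded_bilinear_le _ _ _ _ _ c) => // [|x a].
  split=> [a k x y|x k a b]; apply: fix_val_inj.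
    by rewrite (fix_val_bl _).1 !ractE (fix_val_bl _).1 (ract_bl _ _).1.
  by rewrite (fix_val_bl _).1 !ractE (ract_bl_alg _).1.
by rewrite !fix_norm ractE.
Qed.

Let actA a x b : ract (lact a x) b = lact a (ract x b).
Proof. by apply: fix_val_inj; rewrite !(lactE, ractE) bm_actA. Qed.

(** The projection Q used for syzygies involves the contracting homotopy, which is merely linear. So
    Q is not expected to commute with the actions; what is invariant is its fixed space. *)
Definition fix_bimodule : bimodule A := Bimodule lactP ractP actA.

Lemma fix_val_morphism :
  bimodule_morphism ((fun x : F => fix_val x) : fix_bimodule -> X).
Proof. by split=> [|a x|x a]; [exact: fix_val_bl|exact: lactE|exact: ractE]. Qed.

End FixedBimodule.

Section Lifting.
Context {R : realType} {A : banachAlgebra R}.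
Local Notation C := R[i].
Local Notation Ap := (unitization A).
Variable Ae : enveloping_algebra A.
Local Notation t := (@ta_tens _ _ _ Ae).
Local Notation one := (one_tens Ae).
Variable M : lmodule Ae.
Hypothesis projM : projective M.

Lemma lift_env (X Y : bimodule A) (q : X -> Y) (s : Y -> X) (f : M -> Y) :
  bimodule_morphism q -> bounded_linear s -> cancel s q ->
  module_morphism (f : M -> env Ae Y) ->
  exists2 g : M -> X, module_morphism (g : M -> env Ae X) &
    forall m, q (g m) = f m.
Proof.
move=> hq bs sK hf.
have hq' : module_morphism (q : env Ae X -> env Ae Y) by exact: env_env_morphism.
have [|g hg qg] := projM hq' _ hf; first by exists s.
by exists g.
Qed.

(** The adjunction between restriction to left modules and [coext]: F m is the operator x |-> w (m
    x), with m x written as (1 ⊗ x) m. Evaluating at 1 therefore returns w on the unital part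
    only. *)
Lemma left_coext (N : lmodule Ae) (W : bimodule A) (w : N -> W) :
  left_morphism (w : und N -> W) ->
  exists2 F : N -> coext W, module_morphism (F : N -> env Ae (coext W)) &
    forall m, coext_val (F m) = w (lm_act one m).
Proof.
move=> [bw wl].
pose f (m : N) (x : Ap) : W := w (lm_act (t (uone : Ap) x) m).
have bf : bounded_bilinear f.
  have [c c0 nc] := bounded_bilinear_bound (lm_actP N).1.
  have [d d0 td] := bounded_linear_bound (tensr_bl Ae (uone : Ap)).
  have [k k0 wk] := bounded_linear_bound bw.
  apply: (@bounded_bilinear_le _ _ _ _ _ (k * (c * d))) => [||m x].
  - split=> [x|m]; rewrite /f; apply: proj1.
      exact: bounded_linear_comp bw (lm_bl _ _).
    by apply: bounded_linear_comp bw (bounded_linear_comp (lm_bl_alg m) _);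
      exact: tensr_bl.
  - by rewrite !mulr_ge0.
  rewrite (le_trans (wk _))// -!mulrA ler_wpM2l// (le_trans (nc _ _))//.
  by rewrite -mulrA ler_wpM2l// mulrCA [leRHS]mulrC ler_wpM2r.
have fE m x : (mklmap (f m) : lmap Ap W) x = f m x.
  by rewrite mklmapE//; exact: bounded_bilinearr bf.
exists (fun m => mklmap (f m)); last by move=> m; rewrite /coext_val fE.
apply: env_morphismP => [|m]; last first.
  by apply: bfun_ext => x; rewrite !fE /f -lm_actA one_tensMr.
split=> [|a m|m a]; first exact: mklmap_bl.
  apply: bfun_ext => x; rewrite op_lactE !fE /f -wl.
  by rewrite /= /und_lact -!lm_actA !tensM !umul1 !umulr1.
apply: bfun_ext => x; rewrite coext_ractE !fE /f.
by rewrite /= /und_ract -!lm_actA !tensM !umul1.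
Qed.

Lemma coext_map_bl (X Y : bimodule A) (q : X -> Y) : bounded_linear q ->
  bounded_linear
    (fun F : coext X => mklmap (fun x : Ap => q ((F : lmap Ap X) x)) : coext Y).
Proof.
move=> bq; have [c c0 qc] := bounded_linear_bound bq.
apply: mklmap_bl; apply: (@bounded_bilinear_le _ _ _ _ _ c) => // [|F x].
  split=> [x k F G|F k x y]; first by rewrite bfunDE bfunZE bq.1.
  by rewrite (lmap_bl F).1 bq.1.
by rewrite (le_trans (qc _))// -mulrA ler_wpM2l// le_norm_lmap.
Qed.

Lemma coext_map_morphism (X Y : bimodule A) (q : X -> Y) : left_morphism q ->
  bimodule_morphism
    (fun F : coext X => mklmap (fun x : Ap => q ((F : lmap Ap X) x)) : coext Y).
Proof.
move=> [bq ql].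
have qE (F : lmap Ap X) x : mklmap (fun x => q (F x)) x = q (F x).
  by rewrite mklmapE//; exact: bounded_linear_comp (lmap_bl _).
split=> [|a F|F a]; first exact: coext_map_bl.
  by apply: bfun_ext => x; rewrite !(qE, op_lactE).
by apply: bfun_ext => x; rewrite !(qE, coext_ractE).
Qed.

(* Restriction to left modules preserves projectives because its right adjoint
   coext preserves surjections with bounded linear sections. *)
Lemma left_projective (X Y : bimodule A) (q : X -> Y) (s : Y -> X) (u : M -> Y) :
  left_morphism q -> bounded_linear s -> cancel s q ->
  left_morphism (u : und M -> Y) -> (forall m, u (lm_act one m) = u m) ->
  exists w : M -> X, [/\ left_morphism (w : und M -> X),
    forall m, w (lm_act one m) = w m & forall m, q (w m) = u m].
Proof.
move=> hq bs sK hu u1; have [F hF Fu] := left_coext hu.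
have mE (U V : bimodule A) (r : U -> V) (G : lmap Ap U) x : bounded_linear r ->
    mklmap (fun x => r (G x)) x = r (G x).
  by move=> br; rewrite mklmapE//; exact: bounded_linear_comp (lmap_bl _).
have [|g hg qg] := lift_env (coext_map_morphism hq) (coext_map_bl bs) _ hF.
  move=> G; apply: bfun_ext => x; rewrite (mE _ _ q) ?(mE _ _ s)//.
  exact: hq.1.
have [[bg gl _] g1] := morphism_env hg.
exists (fun m => coext_val (g m)); split=> [|m|m].
- split=> [|a m]; first exact: bounded_linear_comp (coext_val_bl _) bg.
  by rewrite gl coext_val_lact.
- by rewrite g1.
by rewrite -u1 -Fu -qg /coext_val (mE _ _ q)//; exact: hq.1.
Qed.

End Lifting.

(** * Comparison of Ext and Hochschild cohomology *)

Section Resolution.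
Context {R : realType} {A : banachAlgebra R}.
Local Notation C := R[i].
Local Notation Ap := (unitization A).
Variable Ae : enveloping_algebra A.
Local Notation t := (@ta_tens _ _ _ Ae).
Local Notation one := (one_tens Ae).
Variable P : projective_resolution (unitization_module Ae).
Local Notation d := (@res_d _ _ _ P _).
Local Notation aug := (@res_aug _ _ _ P).

Variables (sX : Ap -> P 0) (s : forall n, P n -> P n.+1).
Hypothesis sX_bl : bounded_linear sX.
Hypothesis s_bl : forall n, bounded_linear (@s n).
Hypothesis aug_sX : forall x, aug (sX x) = x.
Hypothesis split0 : forall x, sX (aug x) + d (s x) = x.
Hypothesis splitS : forall n (x : P n.+1), s (d x) + d (s x) = x.

Lemma res_d_bl n : bounded_linear (@res_d _ _ _ P n).
Proof. exact: (res_d_morphism P n).1. Qed.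
Lemma res_d_act n b (x : P n.+1) : d (lm_act b x) = lm_act b (d x).
Proof. exact: (res_d_morphism P n).2. Qed.
Lemma res_aug_bl : bounded_linear aug.
Proof. exact: (res_aug_morphism P).1. Qed.
Lemma res_aug_act b (x : P 0) : aug (lm_act b x) = unitization_act b (aug x).
Proof. exact: (res_aug_morphism P).2. Qed.

Lemma d_exact n (x : P n.+1) : d x = 0 -> d (s x) = x.
Proof. by move=> dx; rewrite -[RHS]splitS dx (bl0 (s_bl n)) add0r. Qed.

Lemma aug_exact (x : P 0) : aug x = 0 -> d (s x) = x.
Proof. by move=> dx; rewrite -[RHS]split0 dx (bl0 sX_bl) add0r. Qed.

(** Thus [d s] is a bounded projection onto the image of [d], which is closed and complemented. *)
Lemma d_sd n (y : P n.+1) : d (s (d y)) = d y.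
Proof. by rewrite -[in RHS](splitS y) (blD (res_d_bl n)) res_dd addr0. Qed.

Lemma one_act (x : Ap) : unitization_act one x = x.
Proof. by rewrite unitization_act_tens umul1 umulr1. Qed.

Lemma one_idem (M : lmodule Ae) (m : M) :
  lm_act one (lm_act one m) = lm_act one m.
Proof. by rewrite -lm_actA one_tensM. Qed.

(* The projection of P n onto the unital part of the n-th syzygy, i.e., of the
   image of d. *)
Definition syz_proj n (x : P n) : P n := lm_act one (d (s x)).

Lemma syz_proj_bl n : bounded_linear (@syz_proj n).
Proof.
apply: bounded_linear_comp (lm_bl _ _) _.
exact: bounded_linear_comp (res_d_bl n) (s_bl n).
Qed.

Lemma syz_projP n (x : P n) : syz_proj x = x <->
  lm_act one x = x /\ d (s x) = x.
Proof.
rewrite /syz_proj; split=> [xE|[x1 ->]//].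
split; first by rewrite -xE one_idem.
by rewrite -{1}xE -res_d_act d_sd res_d_act.
Qed.

Lemma syz_proj_act n b (x : P n) : syz_proj x = x -> lm_act one (lm_act b x) =
  lm_act b x -> syz_proj (lm_act b x) = lm_act b x.
Proof.
move=> /syz_projP[x1 xE] bx; apply/syz_projP; split=> //.
by rewrite -{1}xE -res_d_act d_sd res_d_act xE.
Qed.

Lemma syz_lact n a (x : und (P n)) :
  syz_proj x = x -> syz_proj (a *> x) = a *> x.
Proof. by move=> xE; apply: syz_proj_act => //; exact: und_one_lact. Qed.

Lemma syz_ract n (x : und (P n)) a :
  syz_proj x = x -> syz_proj (x <* a) = x <* a.
Proof. by move=> xE; apply: syz_proj_act => //; exact: und_one_ract. Qed.

Definition syzygy n : bimodule A :=
  @fix_bimodule _ _ (und (P n)) _ (syz_proj_bl n) (@syz_lact n) (@syz_ract n).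

Definition syz_val n (k : syzygy n) : und (P n) :=
  @fix_val _ _ _ (syz_proj_bl n) k.
Definition syz_mk n (x : P n) : syzygy n := fix_mk (syz_proj_bl n) x.

Lemma syz_valP n (k : syzygy n) : syz_proj (syz_val k) = syz_val k.
Proof. exact: fix_valP. Qed.
Lemma syz_mkK n (x : P n) : syz_proj x = x -> syz_val (syz_mk x) = x.
Proof. exact: fix_mkK. Qed.
Lemma syz_val_inj n : injective (@syz_val n).
Proof. exact: fix_val_inj. Qed.
Lemma syz_val_morphism n : bimodule_morphism (@syz_val n).
Proof. exact: fix_val_morphism. Qed.

Definition syz_d n (y : P n.+1) : syzygy n := syz_mk (lm_act one (d y)).

Lemma syz_dP n (y : P n.+1) : syz_proj (lm_act one (d y)) = lm_act one (d y).
Proof. by apply/syz_projP; rewrite one_idem -res_d_act d_sd. Qed.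

Lemma syz_dE n (y : P n.+1) : syz_val (syz_d y) = lm_act one (d y).
Proof. exact/syz_mkK/syz_dP. Qed.

Lemma syz_d_bl n : bounded_linear (@syz_d n).
Proof.
apply: fix_mk_bl (@syz_dP n).
exact: bounded_linear_comp (lm_bl _ _) (res_d_bl n).
Qed.

Lemma syz_d_morphism n : bimodule_morphism (@syz_d n : und (P n.+1) -> syzygy n).
Proof.
have [_ vl vr] := syz_val_morphism n; have [_ ol or] := und_one_morphism (P n).
have [_ dl dr] := und_morphism (res_d_morphism P n).
split=> [|a y|y a]; first exact: syz_d_bl.
  by apply: syz_val_inj; rewrite vl !syz_dE [d _]dl ol.
by apply: syz_val_inj; rewrite vr !syz_dE [d _]dr or.
Qed.

Lemma syz_dK n (k : syzygy n) : syz_d (s (syz_val k)) = k.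
Proof. by apply: syz_val_inj; rewrite syz_dE; exact: syz_valP. Qed.

Lemma syz_lift m n (u : P m -> P n) :
  left_morphism (u : und (P m) -> und (P n)) ->
  (forall p, u (lm_act one p) = u p) -> (forall p, syz_proj (u p) = u p) ->
  exists v : P m -> P n.+1, [/\ left_morphism (v : und (P m) -> und (P n.+1)),
    forall p, v (lm_act one p) = v p & forall p, d (v p) = u p].
Proof.
move=> [bu ul] u1 uQ.
have [bd dl _] := syz_d_morphism n; have [_ vl _] := syz_val_morphism n.
have bs : bounded_linear (fun k : syzygy n => s (syz_val k) : und (P n.+1)).
  exact: bounded_linear_comp (s_bl n) (fix_val_bl _).
have hu : left_morphism ((fun p => syz_mk (u p)) : und (P m) -> syzygy n).
  split=> [|a p]; first exact: fix_mk_bl.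
  by apply: syz_val_inj; rewrite vl !syz_mkK// ul.
have [|p|w [[bw wl] w1 wu]] :=
  left_projective (@res_projective _ _ _ P m) (conj bd dl) bs _ hu.
- exact: syz_dK.
- by rewrite u1.
have [bo ol _] := und_one_morphism (P n.+1).
(* The value of [syz_d] at w p is 1 ⊗ 1 applied to d (w p); moving 1 ⊗ 1 inside makes it d of the
   lift. *)
exists (fun p => lm_act one (w p)); split=> [|p|p]; last 2 first.
- by rewrite w1.
- by rewrite res_d_act -syz_dE wu syz_mkK.
split=> [|a p]; first exact: bounded_linear_comp bo bw.
by rewrite [w _]wl ol.
Qed.

(** As a left module A_+ is free on 1, so the augmentation has a left linear section. From there the
    usual construction of a contracting homotopy goes through with left module maps, on the unital
    parts. *)
Lemma left_homotopy m : exists v : P m -> P m.+1,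
  [/\ left_morphism (v : und (P m) -> und (P m.+1)),
      forall p, v (lm_act one p) = v p
    & forall y : P m.+1, d (v (d y)) = lm_act one (d y)].
Proof.
elim: m => [|m [v [[bv vl] v1 vd]]].
  (* [sX] is only linear; j is the left linear map that takes 1 to the unital part of [sX uone]. *)
  pose j (x : Ap) : P 0 := lm_act (t x (uone : Ap)) (sX (uone : Ap)).
  have augj x : aug (j x) = x.
    by rewrite res_aug_act aug_sX unitization_act_tens !umulr1.
  have bj : bounded_linear j.
    exact: bounded_linear_comp (lm_bl_alg _) (tensl_bl Ae _).
  have j1 x : lm_act one (j x) = j x by rewrite -lm_actA one_tensM.
  pose u (p : P 0) : P 0 := lm_act one p - j (aug p).
  have bu : bounded_linear u.
    apply: bounded_linearB; first exact: lm_bl.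
    exact: bounded_linear_comp bj res_aug_bl.
  have [||p|v [hv v1 vd]] := @syz_lift 0 0 u.
  - split=> // a p; rewrite /u (blB (lact_bl _ a)) /= /und_lact -!lm_actA.
    rewrite one_tensM one_tensMr res_aug_act unitization_act_tens umulr1.
    by rewrite tensM umulr1.
  - by move=> p; rewrite /u one_idem res_aug_act one_act.
  - apply/syz_projP; split; first by rewrite /u (blB (lm_bl _ _)) one_idem j1.
    apply: aug_exact; rewrite /u (blB res_aug_bl) res_aug_act one_act augj.
    exact: subrr.
  by exists v; split=> // y; rewrite vd /u res_augd (bl0 bj) subr0.
(* By the property of v, this is a cycle, so it lies in the syzygy and can be lifted through [d]. *)
pose u (p : P m.+1) : P m.+1 := lm_act one (p - v (d p)).
have bu : bounded_linear u.
  apply: bounded_linear_comp (lm_bl _ _) _.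
  apply: bounded_linearB; first exact: bounded_linear_id.
  exact: bounded_linear_comp bv (res_d_bl m).
have [bo ol _] := und_one_morphism (P m.+1).
have [_ dl _] := und_morphism (res_d_morphism P m).
have [||p|w [hw w1 wd]] := @syz_lift m.+1 m.+1 u.
- split=> // a p; rewrite /u [d _]dl [v _]vl -[RHS]ol; congr lm_act.
  by rewrite [RHS](blB (lact_bl (und (P m.+1)) a)).
- by move=> p; rewrite /u res_d_act v1 !(blB bo) one_idem.
- apply/syz_projP; split; first exact: one_idem.
  apply: d_exact; rewrite /u res_d_act (blB (res_d_bl m)) vd.
  by rewrite (blB (lm_bl _ _)) one_idem subrr.
exists w; split=> // y.
by rewrite wd /u res_dd (bl0 bv) subr0.
Qed.

(* The images of 1 (x) a_1 (x) ... (x) a_m (x) 1 under a morphism from the bar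
   resolution to P. *)
Fixpoint bar_map m : ('I_m -> A) -> P m :=
  match m with
  | 0 => fun=> lm_act one (sX (uone : Ap))
  | m.+1 => fun a =>
      lm_act one (s (@hochschild_d _ A (und (P m)) m (@bar_map m) a))
  end.

Local Notation phi := bar_map.

Lemma bar_map_one m a : lm_act one (phi (m := m) a) = phi a.
Proof. by case: m a => [|m] a; exact: one_idem. Qed.

Lemma bar_map_cochain m :
  hochschild_cochain (phi (m := m) : ('I_m -> A) -> und (P m)).
Proof.
elim: m => [|m IHm]; first exact: cochain_0.
apply: (@cochain_comp _ _ (und (P m)) (und (P m.+1)) _ _
  (fun x => lm_act one (s x))); last exact: cochain_d.
exact: bounded_linear_comp (lm_bl _ _) (s_bl m).
Qed.

Lemma aug_bar_map a : aug (phi (m := 0) a) = uone.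
Proof. by rewrite res_aug_act aug_sX one_act. Qed.

(** The differential of [bar_map] takes its values in cycles, in degree 0 because [aug] sends a 1
    and 1 a to the same element and above by the chain map property one degree lower. On cycles
    [d s] is the identity. *)
Lemma d_bar_map m a : d (phi (m := m.+1) a) =
  @hochschild_d _ A (und (P m)) m (phi (m := m)) a.
Proof.
have e n (b : 'I_n.+1 -> A) :
    lm_act one (@hochschild_d _ A (und (P n)) n (phi (m := n)) b) =
    @hochschild_d _ A (und (P n)) n (phi (m := n)) b.
  rewrite -(hochschild_d_comp _ _ (und_one_morphism (P n))).
  congr (@hochschild_d _ A (und (P n)) n _ b).
  by apply/funext => c; rewrite bar_map_one.
elim: m a => [|m IHm] a /=; rewrite res_d_act.
  rewrite aug_exact// (hochschild_d0 _ _ (fun=> 0)) /= (blB res_aug_bl).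
  rewrite /und_lact /und_ract !res_aug_act aug_sX one_act.
  by rewrite !unitization_act_tens !(umul1, umulr1) subrr.
rewrite d_exact; first exact: e.
rewrite -[LHS](hochschild_d_comp _ _ (und_morphism (res_d_morphism P m))).
rewrite -[RHS](hochschild_dd a (bar_map_cochain m)).
congr (@hochschild_d _ A (und (P m)) m.+1 _ a).
by apply/funext => b; exact: IHm.
Qed.

Lemma bar_map_morphism m (W : bimodule A) (f : P m -> W) (a : 'I_m.+1 -> A) :
  module_morphism (f : P m -> env Ae W) ->
  f (d (phi a)) = hochschild_d (fun b => f (phi b)) a.
Proof.
by move=> /morphism_env[hf _]; rewrite d_bar_map (hochschild_d_comp _ _ hf).
Qed.

Lemma coext_val_bar_map m (W : bimodule A) (h : P m -> coext W)
    (a : 'I_m.+1 -> A) :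
  module_morphism (h : P m -> env Ae (coext W)) ->
  coext_val (h (d (phi a))) = hochschild_d (fun b => coext_val (h (phi b))) a +
    (-1) ^+ m.+1 *: uncurry (fun b => coext_proj (h (phi b))) a.
Proof. by move=> hh; rewrite bar_map_morphism// hochschild_d_coext_val. Qed.

(** Such an h takes values in the copy of W inside [coext W], where the defect in [coext_val_ract]
    disappears. *)
Lemma coext_val_morphism n (W : bimodule A) (h : P n -> coext W) :
  module_morphism (h : P n -> env Ae (coext W)) ->
  (forall p, coext_proj (h p) = 0) ->
  module_morphism ((fun p => coext_val (h p)) : P n -> env Ae W).
Proof.
move=> /morphism_env[[bh hl hr] h1] h0; apply: env_morphismP => [|p].
  split=> [|a p|p a]; first exact: bounded_linear_comp (coext_val_bl _) bh.
    by rewrite hl coext_val_lact.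
  by rewrite hr coext_val_ract h0 bfun0E add0r.
by rewrite h1.
Qed.

Lemma signZK n (W : bimodule A) (x : W) : (-1) ^+ n *: ((-1) ^+ n *: x) = x.
Proof. by rewrite scalerA -expr2 sqrr_sign scale1r. Qed.

Lemma module_morphismZ (M N : lmodule Ae) k (f : M -> N) :
  module_morphism f -> module_morphism (fun x => k *: f x).
Proof.
move=> [bf fb]; split=> [|b x]; first exact: bounded_linearZ.
by rewrite fb (blZ (lm_bl _ _)).
Qed.

Lemma module_morphismB (M N : lmodule Ae) (f g : M -> N) :
  module_morphism f -> module_morphism g -> module_morphism (fun x => f x - g x).
Proof.
move=> [bf fb] [bg gb]; split=> [|b x]; first exact: bounded_linearB.
by rewrite fb gb (blB (lm_bl _ _)).
Qed.

Lemma module_morphism_comp (M N L : lmodule Ae) (g : N -> L) (f : M -> N) :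
  module_morphism g -> module_morphism f -> module_morphism (fun x => g (f x)).
Proof.
move=> [bg gb] [bf fb]; split=> [|b x]; first exact: bounded_linear_comp bg bf.
by rewrite fb gb.
Qed.

(** The comparison in degree 0: a central w gives the module map x |-> x w on A_+, here composed
    with the augmentation. *)
Lemma central_cocycle (W : bimodule A) (w : W) : (forall a, a *> w = w <* a) ->
  ext_cocycle ((fun p => ulact (aug p : Ap) w) : P 0 -> env Ae W).
Proof.
move=> wC; have uC (a : Ap) : ulact a w = uract w a by rewrite /ulact wC.
split=> [|x]; last by rewrite res_augd (bl0 (ulact_bl_alg w)).
apply: env_morphismP => [|p]; last by rewrite res_aug_act one_act.
split=> [|a p|p a].
- exact: bounded_linear_comp (ulact_bl_alg w) res_aug_bl.
- rewrite /= /und_lact res_aug_act unitization_act_tens umulr1.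
  by rewrite ulactA ulact_inj.
rewrite /= /und_ract res_aug_act unitization_act_tens umul1.
by rewrite ulactA uC -[RHS]uract_inj ulactrA.
Qed.

(** Surjectivity of f |-> f [phi] on cohomology. A cocycle with values in [shift W] that represents
    [curry z] lifts to h with values in [coext W] by projectivity; h [d] then lands in W and is the
    connecting image. *)
Lemma ext_cocycle_of_hochschild m (W : bimodule A) (z : ('I_m -> A) -> W) :
  hochschild_cocycle z -> exists2 f : P m -> W,
    ext_cocycle (f : P m -> env Ae W) &
    hochschild_coboundary (fun a => f (phi a) - z a).
Proof.
elim: m W z => [|m IHm] W z [cz dz].
  pose w := z (fun=> 0).
  have wC a : a *> w = w <* a.
    apply/eqP; rewrite -subr_eq0; apply/eqP.
    by have := dz (fun=> a); rewrite (hochschild_d0 _ _ (fun=> 0)).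
  exists (fun p => ulact (aug p : Ap) w); first exact: central_cocycle.
  move=> a; rewrite aug_bar_map ulact1 /w.
  by rewrite (ord0_fun a (fun=> 0)) subrr.
have [|f [hf fd] fz] := IHm (shift W) (curry z).
  split=> [|a]; first exact: cochain_curry.
  by apply: bfun_ext => x; rewrite hochschild_d_curry// dz.
have [h hh hf1] := lift_env (@res_projective _ _ _ P m) (coext_proj_morphism W)
  (coext_sect_bl W) (@coext_sectK _ _ W) hf.
have hd0 p : coext_proj (h (d p)) = 0 by rewrite hf1 fd.
have hv := coext_val_morphism
  (module_morphism_comp hh (res_d_morphism P m)) hd0.
(* The sign cancels the one in [coext_val_bar_map]. *)
exists (fun p => (-1) ^+ m.+1 *: coext_val (h (d p))).
  split=> [|x]; first exact: module_morphismZ.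
  by rewrite res_dd (bl0 hh.1) (bl0 (coext_val_bl W)) scaler0.
have cv : hochschild_cochain (fun b => coext_val (h (phi (m := m) b))).
  apply: (@cochain_comp _ _ (und (P m)) W _ _ (fun p => coext_val (h p))).
    exact: bounded_linear_comp (coext_val_bl W) hh.1.
  exact: bar_map_cochain.
have hE a : (-1) ^+ m.+1 *: coext_val (h (d (phi a))) - z a =
    (-1) ^+ m.+1 *: hochschild_d (fun b => coext_val (h (phi b))) a +
    uncurry (fun b => f (phi b) - curry z b) a.
  rewrite coext_val_bar_map// scalerDr signZK -[in LHS](curryK cz) -addrA.
  congr (_ + _); rewrite /uncurry shiftBE; congr (_ - _).
  by rewrite hf1.
clear IHm.
(* A coboundary in degree 0 is zero, so there the uncurried error simply drops out; in higher
   degrees its primitive g is uncurried as well. *)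
case: m z cz dz f hf fd fz h hh hf1 hd0 hv cv hE
    => [|m] z cz dz f hf fd fz h hh hf1 hd0 hv cv hE.
  exists (fun b => (-1) ^+ 1 *: coext_val (h (phi b))); first exact: cochainZ.
  by move=> a; rewrite hE hochschild_dZ /uncurry fz bfun0E addr0.
have [g cg fg] := fz.
exists (fun b => (-1) ^+ m.+2 *: coext_val (h (phi b)) + uncurry g b).
  by apply: cochain_comb => //; exact: cochain_uncurry.
by move=> a; rewrite hE hochschild_d_comb hochschild_d_uncurry// /uncurry fg.
Qed.

(** Modulo the image of [d], where f vanishes, every p is ([aug] p ⊗ 1) applied to the value of
    [phi]. *)
Lemma ext0_eq0 (W : bimodule A) (f : P 0 -> W) :
  ext_cocycle (f : P 0 -> env Ae W) -> (forall a, f (phi (m := 0) a) = 0) ->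
  forall p, f p = 0.
Proof.
move=> [[bf fb] fd] f0 p; pose b : Ae := t (aug p : Ap) (uone : Ap).
have ap : aug (p - lm_act b (phi (m := 0) (fun=> 0))) = 0.
  rewrite (blB res_aug_bl) res_aug_act aug_bar_map unitization_act_tens.
  by rewrite !umulr1 subrr.
have := fd (s (p - lm_act b (phi (m := 0) (fun=> 0)))).
rewrite aug_exact// (blB bf) fb f0 (bl0 (lm_bl _ _)).
by move=> <-; rewrite subr0.
Qed.

(** Positive Ext classes die in [coext W]: the left homotopy v makes f the coboundary of f v among
    left modules, and the adjunction turns f v into F. Since evaluation of F [d] is f, which
    respects the right action, the defect [coext_proj] vanishes on the image of [d]. *)
Lemma ext_coext m (W : bimodule A) (f : P m.+1 -> W) :
  ext_cocycle (f : P m.+1 -> env Ae W) ->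
  exists F : P m -> coext W, [/\ module_morphism (F : P m -> env Ae (coext W)),
    forall y, coext_val (F (d y)) = f y & forall y, coext_proj (F (d y)) = 0].
Proof.
move=> [hf fd]; have [[bf fl fr] f1] := morphism_env hf.
have [v [[bv vl] v1 vd]] := left_homotopy m.
have hw : left_morphism ((fun p => f (v p)) : und (P m) -> W).
  by split=> [|a p]; [exact: bounded_linear_comp bf bv|rewrite [v _]vl fl].
have [F hF Fv] := left_coext hw.
have {v1}Fv p : coext_val (F p) = f (v p) by rewrite Fv v1.
have Fd y : coext_val (F (d y)) = f y.
  rewrite Fv -[RHS]f1; apply/eqP; rewrite -subr_eq0 -(blB bf); apply/eqP.
  (* v (d y) and 1 ⊗ 1 applied to y differ by a cycle, hence by a boundary, which f kills. *)
  rewrite -[X in f X]d_exact ?fd// (blB (res_d_bl _)) vd res_d_act.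
  exact: subrr.
exists F; split=> // y; have [[_ _ Fr] _] := morphism_env hF.
have [_ _ dr] := und_morphism (res_d_morphism P m).
apply: bfun_ext => x; have := coext_val_ract (F (d y)) x.
rewrite -Fr -[(d y : und _) <* x]dr !Fd fr => /eqP.
by rewrite -subr_eq subrr => /eqP <-.
Qed.

(** Injectivity of the comparison. F from [ext_coext] has coboundary f but need not take values in
    W; the obstruction [coext_proj] F is a cocycle one degree lower. Once it is itself a coboundary,
    lifting a primitive to [coext W] and subtracting corrects F without changing its coboundary. *)
Lemma ext_coboundary_of_hochschild m (W : bimodule A) (f : P m.+1 -> W)
    (g : ('I_m -> A) -> W) :
  ext_cocycle (f : P m.+1 -> env Ae W) -> hochschild_cochain g ->
  (forall a, f (phi a) = hochschild_d g a) ->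
  ext_coboundary (f : P m.+1 -> env Ae W).
Proof.
elim: m W f g => [|m IHm] W f g hf cg fg;
  have [F [hF Fd Fp]] := ext_coext hf; have bF : bounded_linear F := hF.1;
  have bp := coext_proj_bl W; have bv := coext_val_bl W.
- suff [H hH [Hd HF]] : exists2 H : P 0 -> coext W,
      module_morphism (H : P 0 -> env Ae (coext W)) &
      (forall y, H (d y) = 0) /\ forall p, coext_proj (H p) = coext_proj (F p).
    have hB := module_morphismB hF hH.
    exists (fun p => coext_val (F p - H p)); last first.
      by move=> y; rewrite Hd subr0 Fd.
    by apply: coext_val_morphism => // p; rewrite (blB bp) HF subrr.
  (* In degree 0 the correction is a central element j of [coext W] with the same projection as F
     [phi]. By [coext_val_bar_map] and the hypothesis on g, that projection is x |-> x u - u x,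
     which is also the projection of the central operator x |-> x u. *)
  pose u := coext_val (F (phi (m := 0) (fun=> 0))) - g (fun=> 0).
  have bu : bounded_linear (fun x : Ap => ulact x u) := ulact_bl_alg u.
  pose j : coext W := mklmap (fun x : Ap => ulact x u).
  have jE x : (j : lmap Ap W) x = ulact x u by rewrite mklmapE.
  have jC a : a *> j = j <* a.
    apply: bfun_ext => x.
    by rewrite op_lactE coext_ractE !jE ulactA ulact_inj.
  have [hH Hd] := central_cocycle jC.
  have pj : bimodule_morphism (@coext_proj _ _ W) := coext_proj_morphism W.
  exists (fun p => ulact (aug p : Ap) j) => //; split=> // p.
  apply/eqP; rewrite -subr_eq0 -(blB bp); apply/eqP.
  apply: (@ext0_eq0 (shift W) (fun p => coext_proj (ulact (aug p : Ap) j - F p))).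
    split=> [|y]; last by rewrite Hd (blB bp) (bl0 bp) Fp subr0.
    apply: (module_morphism_comp (env_env_morphism Ae pj)).
    exact: module_morphismB.
  move=> a; rewrite aug_bar_map ulact1 (ord0_fun a (fun=> 0)).
  apply: bfun_ext => x; rewrite (blB bp) shiftBE coext_projE /coext_val !jE.
  rewrite ulact_inj ulact1.
  have := coext_val_bar_map (snoc (fun=> 0) x) hF.
  rewrite Fd fg !(hochschild_d0 _ _ (fun=> 0)) /uncurry snoc_max init_snoc.
  rewrite snoc_ord0 expr1 scaleN1r => E.
  rewrite /u (blB (lact_bl _ _)) (blB (ract_bl _ _)).
  apply: etrans (subrr (x *> g (fun=> 0) - g (fun=> 0) <* x)).
  by rewrite {1}E !opprB !addrA [LHS](ACl (1*4*5*3*2)).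
pose v b := coext_val (F (phi (m := m.+1) b)).
have cv : hochschild_cochain v.
  apply: (@cochain_comp _ _ (und (P m.+1)) W _ _ (fun p => coext_val (F p))).
    exact: bounded_linear_comp bv bF.
  exact: bar_map_cochain.
(* Solving [coext_val_bar_map] for its last term gives the primitive k of the obstruction. *)
pose k b := (-1) ^+ m.+2 *: (g b - v b).
have ck : hochschild_cochain k by apply: cochainZ; exact: cochainB.
have uk a : uncurry (fun b => coext_proj (F (phi (m := m.+1) b))) a =
    hochschild_d k a.
  rewrite hochschild_dZ hochschild_dB -fg -Fd coext_val_bar_map// -/v.
  by rewrite addrAC subrr add0r signZK.
have [||a|H hH HF] := IHm (shift W) (fun p => coext_proj (F p)) (curry k).
- split=> // ; apply: module_morphism_comp hF.
  exact: env_env_morphism (coext_proj_morphism W).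
- exact: cochain_curry.
- apply: bfun_ext => x; rewrite hochschild_d_curry// -uk.
  by rewrite /uncurry snoc_max init_snoc.
have [h hh hH1] := lift_env (@res_projective _ _ _ P m) (coext_proj_morphism W)
  (coext_sect_bl W) (@coext_sectK _ _ W) hH.
have hB := module_morphismB hF (module_morphism_comp hh (res_d_morphism P m)).
exists (fun p => coext_val (F p - h (d p))); last first.
  by move=> y; rewrite res_dd (bl0 hh.1) subr0 Fd.
by apply: coext_val_morphism => // p; rewrite (blB bp) hH1 HF subrr.
Qed.

End Resolution.

(** * Bounded sequences and the Neumann series *)

Section BoundedSequences.
Context {R : realType} {A : banachAlgebra R}.
Local Notation C := R[i].
Variable E : bimodule A.

Definition linfty_data : bfun_data nat E :=
  @BfunData R nat E (fun=> 1) (fun=> True) (fun=> ler01) I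
    (fun _ _ _ _ _ => I) (fun _ _ => I).

Local Notation L := (bfun linfty_data).

Let mkE (f : nat -> E) (c : C) : 0 <= c -> (forall j, `|f j| <= c) ->
  mkbfun linfty_data f = f :> (nat -> E).
Proof.
by move=> c0 fc; rewrite mkbfunE//; split=> //; exists c => // j; rewrite mulr1.
Qed.

Let le_norm (u : L) j : `|u j| <= `|u|.
Proof. by rewrite -[leRHS]mulr1; exact: le_norm_bfun. Qed.

Let norm_le (u : L) (c : C) : 0 <= c -> (forall j, `|u j| <= c) -> `|u| <= c.
Proof. by move=> c0 uc; apply: norm_bfun_le => // j; rewrite mulr1. Qed.

Let lact (a : A) (u : L) : L := mkbfun linfty_data (fun j => a *> (u j : E)).
Let ract (u : L) (a : A) : L := mkbfun linfty_data (fun j => (u j : E) <* a).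

Let lactE a u j : lact a u j = a *> (u j : E).
Proof.
have [c c0 lc] := bounded_linear_bound (lact_bl E a).
rewrite /lact (@mkE _ (c * `|u|)) ?mulr_ge0// => k.
by rewrite (le_trans (lc _))// ler_wpM2l.
Qed.

Let ractE a u j : ract u a j = (u j : E) <* a.
Proof.
have [c c0 lc] := bounded_linear_bound (ract_bl E a).
rewrite /ract (@mkE _ (c * `|u|)) ?mulr_ge0// => k.
by rewrite (le_trans (lc _))// ler_wpM2l.
Qed.

Let lactP : is_left_action lact.
Proof.
split=> [|a b u]; last by apply: bfun_ext => j; rewrite !lactE lactA.
have [c c0 lc] := bounded_bilinear_bound (bm_lactP E).1.
apply: (@bounded_bilinear_le _ _ _ _ _ c) => // [|a u].
  split=> [u k a b|a k u v]; apply: bfun_ext => j.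
    by rewrite bfunDE bfunZE !lactE (lact_bl_alg _).1.
  by rewrite bfunDE bfunZE !lactE bfunDE bfunZE (lact_bl _ _).1.
apply: norm_le => [|j]; first by rewrite !mulr_ge0.
by rewrite lactE (le_trans (lc _ _))// ler_wpM2l// mulr_ge0.
Qed.

Let ractP : is_right_action ract.
Proof.
split=> [|u a b]; last by apply: bfun_ext => j; rewrite !ractE ractA.
have [c c0 lc] := bounded_bilinear_bound (bm_ractP E).1.
apply: (@bounded_bilinear_le _ _ _ _ _ c) => // [|u a].
  split=> [a k u v|u k a b]; apply: bfun_ext => j.
    by rewrite bfunDE bfunZE !ractE bfunDE bfunZE (ract_bl _ _).1.
  by rewrite bfunDE bfunZE !ractE (ract_bl_alg _).1.
apply: norm_le => [|j]; first by rewrite !mulr_ge0.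
by rewrite ractE (le_trans (lc _ _))// ler_wpM2r// ler_wpM2l.
Qed.

Let actA a u b : ract (lact a u) b = lact a (ract u b).
Proof. by apply: bfun_ext => j; rewrite !(lactE, ractE) bm_actA. Qed.

Definition linfty : bimodule A := Bimodule lactP ractP actA.

Definition linfty_nth (j : nat) (u : linfty) : E := (u : L) j.

Lemma linfty_nth_morphism j : bimodule_morphism (linfty_nth j).
Proof.
split=> [|a u|u a]; first exact: bounded_linear_eval.
  exact: lactE.
exact: ractE.
Qed.

Lemma linfty_nth_norm j u : `|linfty_nth j u| <= `|u|.
Proof. exact: le_norm. Qed.

(** The common bound keeps the sequences bounded and bounds z; the cocycle identity holds
    coordinatewise because coordinates are bimodule maps. *)
Lemma linfty_cocycle n (r : nat -> ('I_n -> A) -> E) :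
  (forall j, hochschild_cocycle (r j)) ->
  (forall j a, `|r j a| <= \prod_(i < n) `|a i|) ->
  exists2 z : ('I_n -> A) -> linfty, hochschild_cocycle z &
    forall j a, linfty_nth j (z a) = r j a.
Proof.
move=> rC r1; pose z a : linfty := mkbfun linfty_data (fun j => r j a).
have zE j a : linfty_nth j (z a) = r j a.
  rewrite /linfty_nth /z (@mkE _ (\prod_(i < n) `|a i|))//.
  by rewrite prodr_ge0.
exists z => //; split=> [|a].
  split=> [a i k x y|].
    by apply: bfun_ext => j; rewrite bfunDE bfunZE ![z _ j]zE (rC j).1.1.
  exists 1 => a; rewrite mul1r; apply: norm_le => [|j]; first by rewrite prodr_ge0.
  by rewrite [z a j]zE.
apply: bfun_ext => j; have := hochschild_d_comp z a (linfty_nth_morphism j).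
rewrite /linfty_nth => <-; rewrite -[RHS]((rC j).2 a).
by congr hochschild_d; apply/funext => b; exact: zE.
Qed.

End BoundedSequences.

Section Neumann.
Context {R : realType}.
Local Notation C := R[i].

Lemma complex_archi (x e : C) : 0 <= x -> 0 < e ->
  exists N : nat, x < e * N.+1%:R.
Proof.
move=> x0 e0; pose y := complex.Re (x / e).
have yE : (y%:C)%C = x / e by apply/RRe_real/ger0_real; rewrite divr_ge0// ltW.
have y0 : 0 <= y by rewrite -ler0c yE divr_ge0// ltW.
exists (Num.bound y); rewrite mulrC -ltr_pdivrMr// -yE.
rewrite -(rmorph_nat (real_complex R)) ltcR.
by rewrite (lt_le_trans (archi_boundP y0))// ler_nat.
Qed.

Variables (E : completeNormedModType C) (r : E -> E).
Hypothesis br : bounded_linear r.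
Hypothesis r2 : forall x, `|r x| <= 2^-1 * `|x|.

Lemma neumann_inj x : x - r x = 0 -> x = 0.
Proof.
move=> /eqP; rewrite subr_eq0 => /eqP xr; apply/eqP; rewrite -normr_le0.
have := r2 x; rewrite -xr -subr_ge0 -{2}[`|x|]mul1r -mulrBl.
have -> : 2^-1 - 1 = - 2^-1 :> C.
  by rewrite [X in _ - X](@splitr C) mul1r opprD addrA subrr add0r.
by rewrite mulNr oppr_ge0 pmulr_rle0// invr_gt0.
Qed.

Lemma neumann_surj x : exists y, y - r y = x.
Proof.
(* The partial sums of the Neumann series, as iterates of y |-> x + r y. *)
pose y := fix y k : E := if k is k.+1 then x + r (y k) else 0.
have step k : `|y k.+1 - y k| <= 2^-1 ^+ k * `|x|.
  elim: k => [|k IHk]; first by rewrite /= (bl0 br) addr0 subr0 mul1r.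
  rewrite [y k.+2]/= [y k.+1 in X in _ - X]/= opprD addrACA subrr add0r.
  by rewrite -(blB br) (le_trans (r2 _))// exprS -mulrA ler_wpM2l// invr_ge0.
have dist k l : `|y (k + l)%N - y k| <= 2 * 2^-1 ^+ k * `|x|.
  suff : `|y (k + l)%N - y k| <= 2 * (2^-1 ^+ k - 2^-1 ^+ (k + l)) * `|x|.
    move=> /le_trans; apply; rewrite ler_wpM2r// ler_wpM2l// gerBl.
    by rewrite exprn_ge0// invr_ge0.
  elim: l => [|l IHl]; first by rewrite addn0 !subrr mulr0 mul0r normr0.
  rewrite addnS -[y (k + l).+1](subrK (y (k + l)%N)) -addrA.
  rewrite (le_trans (ler_normD _ _))// (le_trans (lerD (step _) IHl))//.
  rewrite -mulrDl ler_wpM2r// !mulrBr addrCA lerD2l exprS mulrA.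
  by rewrite divff ?pnatr_eq0// mul1r mulr_natl mulr2n opprD addrA subrr add0r.
have ycvg : cvg (y @ \oo).
  apply/cauchy_cvgP/cauchy_exP => e e0 /=.
  have x2 : 0 <= 2 * `|x| by rewrite mulr_ge0.
  have [N xN] := complex_archi x2 e0.
  exists (y N); exists N => // k /= Nk; rewrite -ball_normE /= distrC.
  rewrite -(subnKC Nk) (le_lt_trans (dist _ _))// mulrAC exprVn.
  rewrite ltr_pdivrMr ?exprn_gt0// (lt_le_trans xN)// ler_wpM2l ?(ltW e0)//.
  by rewrite -(natrX _ 2) ler_nat ltn_expl.
have [/= l yl] := (cvg_ex (y @ \oo)).1 ycvg.
exists l; apply/eqP; rewrite -subr_eq0; apply/eqP.
apply: (@small_eq0 _ _ _ 2) => // e e0.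
have ev : \forall k \near \oo, `|l - y k| < e by exact: (cvgr_dist_lt _ _ yl).
have [N _ Ny] := ev.
have -> : l - r l - x = (l - y N.+1) - r (l - y N).
  by rewrite (blB br) /= opprD opprB !addrA subrK addrAC.
rewrite (le_trans (ler_normB _ _))// mulrDr mulr1 lerD//.
  by rewrite ltW// Ny//=.
rewrite (le_trans (r2 _))// (le_trans (ler_piMl _ _))//.
  by rewrite invf_le1// ler1n.
by rewrite ltW// Ny/=.
Qed.

End Neumann.

Section NeumannMorphism.
Context {R : realType} {A : banachAlgebra R}.
Variables (E : bimodule A) (r : E -> E).

(** The inverse commutes with the actions because 1 - r does and is injective; the bound 2 comes
    from |S x| <= |x| + |S x| / 2. *)
Lemma neumann_morphism : bimodule_morphism r ->
  (forall x, `|r x| <= 2^-1 * `|x|) ->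
  exists2 S : E -> E, bimodule_morphism S & forall x, S (x - r x) = x.
Proof.
move=> [br rl rr] r2.
have /choice[S SP] : forall x, exists y, y - r y = x := neumann_surj br r2.
have inj x y : x - r x = y - r y -> x = y.
  move=> /eqP; rewrite -subr_eq0 => /eqP xy; apply/eqP; rewrite -subr_eq0.
  apply/eqP/(neumann_inj r2); rewrite (blB br) -[RHS]xy !opprD !opprK !addrA.
  by rewrite [LHS](ACl (1*3*2*4)).
exists S => [|x]; last by apply: inj; rewrite SP.
split=> [|a x|x a]; last 2 first.
- by apply: inj; rewrite SP rl -(blB (lact_bl _ _)) SP.
- by apply: inj; rewrite SP rr -(blB (ract_bl _ _)) SP.
apply: (@bounded_linear_le _ _ _ _ 2) => // [k x y|x].
  apply: inj; rewrite SP br.1 opprD addrACA -scalerBr SP.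
  by congr (_ + _); rewrite SP.
have h : `|S x| <= `|x| + 2^-1 * `|S x|.
  by rewrite -{1}[S x](subrK (r (S x))) SP (le_trans (ler_normD _ _))// lerD2l.
rewrite -ler_pdivrMl//; move: h.
by rewrite [X in X <= _ -> _]splitr [_ / 2]mulrC lerD2r.
Qed.

End NeumannMorphism.

(** * Extension of the syzygy *)

Section Bidual.
Context {R : realType}.
Local Notation C := R[i].

Section Transpose.
Variables (V Z : normedModType C) (T : V -> dual_space Z).
Hypothesis bT : bounded_linear T.

Lemma transpose_bl z : bounded_linear (fun v => T v z : C).
Proof.
have [c c0 Tc] := bounded_linear_bound bT.
apply: (@bounded_linear_le _ _ _ _ (c * `|z|)) => [k x y||x].
- by rewrite bT.1.
- exact: mulr_ge0.
by rewrite (le_trans (le_norm_dual _ _))// mulrAC ler_wpM2r.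
Qed.

Definition transpose z : dual_space V := dual_of (transpose_bl z).

Lemma transpose_norm c z : 0 <= c -> (forall v, `|T v| <= c * `|v|) ->
  `|transpose z| <= c * `|z|.
Proof.
move=> c0 Tc; apply: norm_dual_le => [|v]; first exact: mulr_ge0.
by rewrite (le_trans (le_norm_dual (T v) z))// mulrAC ler_wpM2r.
Qed.

Lemma transpose_linear : linear transpose.
Proof.
by move=> k x y; apply: dual_ext => v; exact: (dual_bounded_linear (T v)).1.
Qed.

Lemma transpose_bounded : bounded_linear transpose.
Proof.
have [c c0 Tc] := bounded_linear_bound bT.
apply: (@bounded_linear_le _ _ _ _ c) => // [|z]; first exact: transpose_linear.
exact: transpose_norm.
Qed.

End Transpose.

Variable V : normedModType C.

Lemma dual_eval_bl (v : V) : bounded_linear (fun f : dual_space V => f v : C).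
Proof.
apply: (@bounded_linear_le _ _ _ _ `|v|) => // f.
by rewrite mulrC le_norm_dual.
Qed.

Definition dual_eval (v : V) : dual_space (dual_space V) :=
  dual_of (dual_eval_bl v).

Lemma dual_eval_bounded : bounded_linear dual_eval.
Proof.
apply: (@bounded_linear_le _ _ _ _ 1) => // [k x y|v].
  by apply: dual_ext => f; exact: (dual_bounded_linear f).1.
apply: norm_dual_le => [|f]; first by rewrite mul1r.
by rewrite mul1r mulrC; exact: le_norm_dual f v.
Qed.

Variables (Z : normedModType C) (T : V -> dual_space Z).
Hypothesis bT : bounded_linear T.

Lemma bidual_ext_bl (Phi : dual_space (dual_space V)) :
  bounded_linear (fun z => Phi (transpose bT z) : C).
Proof.
exact: bounded_linear_comp (dual_bounded_linear Phi) (transpose_bounded bT).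
Qed.

(** The second adjoint of T followed by restriction of functionals to Z; this last projection is
    what a dual target offers. *)
Definition bidual_ext (Phi : dual_space (dual_space V)) : dual_space Z :=
  dual_of (bidual_ext_bl Phi).

Lemma bidual_extK v : bidual_ext (dual_eval v) = T v.
Proof. exact: dual_ext. Qed.

(** The same c on both sides keeps the bound 1/2, as the Neumann series requires. *)
Lemma bidual_ext_norm c Phi : 0 <= c -> (forall v, `|T v| <= c * `|v|) ->
  `|bidual_ext Phi| <= c * `|Phi|.
Proof.
move=> c0 Tc; apply: norm_dual_le => [|z]; first exact: mulr_ge0.
rewrite (le_trans (le_norm_dual Phi _))// [c * _]mulrC -mulrA ler_wpM2l//.
exact: transpose_norm.
Qed.

Lemma bidual_ext_bounded : bounded_linear bidual_ext.
Proof.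
have [c c0 Tc] := bounded_linear_bound bT.
apply: (@bounded_linear_le _ _ _ _ c) => // [k x y|Phi].
  by apply: dual_ext.
exact: bidual_ext_norm.
Qed.

End Bidual.

(** * Extending maps from the syzygy to P n *)

Section SyzygyExtension.
Context {R : realType} {A : banachAlgebra R}.
Local Notation C := R[i].
Local Notation Ap := (unitization A).
Variable Ae : enveloping_algebra A.
Local Notation one := (one_tens Ae).
Variable P : projective_resolution (unitization_module Ae).
Local Notation d := (@res_d _ _ _ P _).
Local Notation aug := (@res_aug _ _ _ P).

Variables (sX : Ap -> P 0) (s : forall n, P n -> P n.+1).
Hypothesis sX_bl : bounded_linear sX.
Hypothesis s_bl : forall n, bounded_linear (@s n).
Hypothesis aug_sX : forall x, aug (sX x) = x.
Hypothesis split0 : forall x, sX (aug x) + d (s x) = x.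
Hypothesis splitS : forall n (x : P n.+1), s (d x) + d (s x) = x.
Local Notation syz := (syzygy s_bl splitS).
Local Notation sval := (@syz_val _ _ _ _ _ s_bl splitS _).
Local Notation sd := (@syz_d _ _ _ _ _ s_bl splitS _).
Local Notation phi := (@bar_map _ _ _ _ sX s _).

Lemma env_env_bimodule (X Y : bimodule A) (f : X -> Y) :
  module_morphism (f : env Ae X -> env Ae Y) -> bimodule_morphism f.
Proof.
move=> [bf fb]; split=> // [a x|x a].
  by rewrite -[RHS](@env_ltens _ _ Ae) -fb env_ltens.
by rewrite -[RHS](@env_rtens _ _ Ae) -fb env_rtens.
Qed.

Lemma ext_cocycle_s n (Y : lmodule Ae) (f : P n.+1 -> Y) y :
  ext_cocycle f -> f (s (d y)) = f y.
Proof. by move=> [[bf _] fd]; rewrite -[in RHS](splitS y) (blD bf) fd addr0. Qed.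

Lemma ext_cocycle_syz n (Y : lmodule Ae) (f : P n.+1 -> Y) y :
  ext_cocycle f -> f (s (sval (sd y))) = lm_act one (f y).
Proof.
by move=> hf; rewrite syz_dE -res_d_act (ext_cocycle_s _ hf) hf.1.2.
Qed.

(** Although [s] is merely linear, every k is [sd] of some y, and there f [s] equals 1 ⊗ 1 applied
    to f y, independently of the choice of [s]. *)
Lemma ext_cocycle_factor n (Y : lmodule Ae) (f : P n.+1 -> Y) : ext_cocycle f ->
  module_morphism ((fun k => f (s (sval k))) : env Ae (syz n) -> Y).
Proof.
move=> hf; have fs y := ext_cocycle_syz y hf.
have [_ dl dr] := syz_d_morphism s_bl splitS n.
apply: module_morphismP => [|a k|a k|k].
- apply: bounded_linear_comp hf.1.1 _.
  exact: bounded_linear_comp (s_bl n) (fix_val_bl _).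
- rewrite env_ltens -{1}(syz_dK k) -dl fs -[in RHS](syz_dK k) fs.
  by rewrite [f _]hf.1.2 -!lm_actA one_tensM one_tensMr.
- rewrite env_rtens -{1}(syz_dK k) -dr fs -[in RHS](syz_dK k) fs.
  by rewrite [f _]hf.1.2 -!lm_actA one_tensM one_tensMr.
by rewrite env_one -(syz_dK k) fs one_idem.
Qed.

Section Approximation.
Variables (n : nat) (E : bimodule A) (i : syz n -> E).
Hypothesis hi : bimodule_morphism i.
Hypothesis triv : hochschild_trivial_topology E n.+1.

(** E and i will be the syzygy with the identity in (i), and its bidual with the canonical embedding
    in (ii). *)
Let c (a : 'I_n.+1 -> A) : E := i (sd (phi a)).

Let c_cocycle : hochschild_cocycle c.
Proof.
have hs := syz_d_morphism s_bl splitS n.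
split=> [|a]; last first.
  rewrite (hochschild_d_comp (fun a => sd (phi a)) a hi).
  rewrite (hochschild_d_comp (phi : _ -> und (P n.+1)) a hs).
  rewrite -d_bar_map//; have [bi _ _] := hi; rewrite -[RHS](bl0 bi); congr i.
  by apply: syz_val_inj; rewrite syz_dE res_dd (bl0 (lm_bl _ _)).
apply: (@cochain_comp _ _ (und (P n.+1)) E _ _ (fun p => i (sd p))).
  by apply: bounded_linear_comp; [case: hi|case: hs].
exact: bar_map_cochain.
Qed.

(* Approximating c to within 1/(j+1) for every j, the rescaled errors form a
   single bounded cocycle with values in the bounded sequences of E; one module
   map rho represents it, and rho_j / (j+1) is small for large j. *)
Lemma small_error : exists2 rho : syz n -> E,
  bimodule_morphism rho /\ (forall k, `|rho k| <= 2^-1 * `|k|) &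
  exists2 g : ('I_n -> A) -> E, hochschild_cochain g &
    forall a, i (sd (phi a)) - rho (sd (phi a)) = hochschild_d g a.
Proof.
have ji j : 0 < j.+1%:R^-1 :> C by rewrite invr_gt0.
have /choice[h hP] : forall j : nat, exists h : ('I_n -> A) -> E,
    hochschild_cochain h /\ forall a,
    `|c a - hochschild_d h a| <= j.+1%:R^-1 * \prod_(i < n.+1) `|a i|.
  move=> j; have [g [h ch gh] cg] := triv c_cocycle (ji j).
  by exists h; split=> // a; rewrite -gh.
pose r j a : E := j.+1%:R *: (c a - hochschild_d (h j) a).
have rC j : hochschild_cocycle (r j).
  have cd := cochain_d (hP j).1.
  split=> [|a]; first by apply: cochainZ; exact: cochainB c_cocycle.1 cd.
  by rewrite hochschild_dZ hochschild_dB c_cocycle.2 hochschild_dd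
    ?subrr ?scaler0//; exact: (hP j).1.
have [j a|z zC zr] := linfty_cocycle rC.
  by rewrite normrZ normr_nat -ler_pdivlMl// (hP j).2.
have [f hf [G cG fG]] :=
  ext_cocycle_of_hochschild sX_bl s_bl aug_sX split0 splitS zC.
pose rho k : linfty E := f (s (sval k)).
have hrho : bimodule_morphism rho.
  exact: (env_env_bimodule (ext_cocycle_factor hf)).
have rhoE a : rho (sd (phi a)) = f (phi a).
  by rewrite /rho (ext_cocycle_syz _ hf) env_one.
have [M M0 rM] := bounded_linear_bound (let: And3 b _ _ := hrho in b).
have h2 : 0 < 2^-1 :> C by rewrite invr_gt0.
(* M bounds all coordinates of rho at once, and j is chosen with M / (j+1) < 1/2. *)
have [j Mj] := complex_archi M0 h2.
have hj := @linfty_nth_morphism _ _ E j; have [bj jl jr] := hj.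
have [br rl rr] := hrho.
exists (fun k => j.+1%:R^-1 *: linfty_nth j (rho k)).
  split=> [|k].
    split=> [|a k|k a].
    - exact/bounded_linearZ/(bounded_linear_comp bj br).
    - by rewrite rl jl (blZ (lact_bl _ _)).
    - by rewrite rr jr (blZ (ract_bl _ _)).
  rewrite normrZ gtr0_norm//.
  rewrite ler_pdivrMl// (le_trans (linfty_nth_norm _ _))// (le_trans (rM _))//.
  by rewrite mulrA ler_wpM2r// mulrC ltW.
(* c minus the differential of [h j] is [r j] / (j+1), and the j-th coordinate of f [phi] is [r j]
   plus the differential of the j-th coordinate of G. *)
exists (fun a => (- j.+1%:R^-1) *: linfty_nth j (G a) + h j a).
  by apply: cochain_comb (hP j).1; exact: cochain_comp bj cG.
move=> a; rewrite rhoE hochschild_d_comb hochschild_d_comp// -fG.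
rewrite (blB bj) zr /r scalerBr scalerA scaleNr mulNr mulVf ?pnatr_eq0//.
by rewrite scaleN1r opprK -addrA subrK addrC.
Qed.

(** rho starts on the syzygy; inverting requires an endomorphism of E extending it along i. *)
Hypothesis small_ext : forall rho : syz n -> E, bimodule_morphism rho ->
  (forall k, `|rho k| <= 2^-1 * `|k|) ->
  exists r : E -> E, [/\ bimodule_morphism r,
    forall x, `|r x| <= 2^-1 * `|x| & forall k, r (i k) = rho k].

(** i - rho = (1 - r) i is a coboundary on [phi]; applying the inverse S of 1 - r, a bimodule map,
    shows that i [sd] is one too, and injectivity of the comparison yields h. *)
Lemma syzygy_extension : exists2 h : P n -> E,
  module_morphism (h : P n -> env Ae E) & forall y, h (d y) = i (sd y).
Proof.
have [rho [hrho rho2] [g cg gE]] := small_error.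
have [r [hr r2 rE]] := small_ext hrho rho2.
have [S hS SE] := neumann_morphism hr r2.
have hs := syz_d_morphism s_bl splitS n.
have sd1 y : sd (lm_act one y) = sd y.
  by apply: syz_val_inj; rewrite !syz_dE res_d_act one_idem.
have [||a|h hh hd] := ext_coboundary_of_hochschild (m := n) (W := E)
    sX_bl s_bl aug_sX split0 splitS (f := fun y => i (sd y)) (g := fun a => S (g a)).
- split=> [|y]; last first.
    have [bi _ _] := hi; rewrite -[RHS](bl0 bi); congr i.
    by apply: syz_val_inj; rewrite syz_dE res_dd (bl0 (lm_bl _ _)).
  apply: env_morphismP => [|y]; last by rewrite sd1.
  have [[bi il ir] [bs sl sr]] := (hi, hs).
  split=> [|a y|y a]; first exact: bounded_linear_comp bi bs.
    by rewrite sl il.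
  by rewrite sr ir.
- by apply: cochain_comp cg; case: hS.
- by rewrite hochschild_d_comp// -gE -rE SE.
by exists h.
Qed.

End Approximation.

(** Composed with [d], the map fe h gives only 1 ⊗ 1 applied to f; the second summand of the witness
    supplies the difference. *)
Lemma ext_coboundary_of_extension n (E : bimodule A) (i : syz n -> E)
    (h : P n -> E) (Y : lmodule Ae) (f : P n.+1 -> Y) (fe : E -> Y) :
  module_morphism (h : P n -> env Ae E) -> (forall y, h (d y) = i (sd y)) ->
  ext_cocycle f -> module_morphism (fe : env Ae E -> Y) ->
  (forall k, fe (i k) = f (s (sval k))) -> ext_coboundary f.
Proof.
move=> hh hd hf hfe fei; have [[bf fb] fd] := hf.
have bo (M : lmodule Ae) : bounded_linear (lm_act one : M -> M) := lm_bl M one.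
(* Ae acts as zero on the nonunital part of P n, where the contracting homotopy
   is a module map. *)
pose z (p : P n) : Y := f (s (p - lm_act one p)).
have bz : bounded_linear z.
  apply: bounded_linear_comp bf _; apply: bounded_linear_comp (s_bl n) _.
  exact: bounded_linearB (bounded_linear_id _) (bo _).
exists (fun p => fe (h p) + (z p - lm_act one (z p))) => [|y]; last first.
  rewrite hd fei (ext_cocycle_syz _ hf) /z -res_d_act -(blB (res_d_bl _ _)).
  rewrite (ext_cocycle_s _ hf) (blB bf) fb (blB (bo _)) one_idem subrr subr0.
  by rewrite addrC subrK.
split=> [|b p].
  apply: bounded_linearD; first exact: bounded_linear_comp hfe.1 hh.1.
  exact: bounded_linearB bz (bounded_linear_comp (bo _) bz).
rewrite hh.2 hfe.2 (blD (lm_bl _ b)); congr (_ + _).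
rewrite (blB (lm_bl _ b)) -[in RHS]lm_actA one_tensMr subrr.
by rewrite /z -lm_actA one_tensM subrr (bl0 (s_bl n)) (bl0 bf) (bl0 (bo _)) subr0.
Qed.

Lemma ext_coboundary_trivial n (Y : lmodule Ae) (f : P n.+1 -> Y) :
  (forall X : bimodule A, hochschild_trivial_topology X n.+1) ->
  ext_cocycle f -> ext_coboundary f.
Proof.
move=> triv hf.
have hid : bimodule_morphism (fun k : syz n => k).
  by split=> //; exact: bounded_linear_id.
have [rho hrho rho2|h hh hd] := syzygy_extension hid (triv _).
  by exists rho.
by apply: (ext_coboundary_of_extension hh hd hf (ext_cocycle_factor hf)).
Qed.

Lemma dual_eval_morphism (X : bimodule A) :
  bimodule_morphism (@dual_eval _ X : X -> dual_bimodule (dual_bimodule X)).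
Proof.
split=> [|a x|x a]; first exact: dual_eval_bounded.
  exact: dual_ext.
exact: dual_ext.
Qed.

Lemma bidual_ext_morphism (X Z : bimodule A) (T : X -> dual_bimodule Z)
    (hT : bimodule_morphism T) (bT : bounded_linear T) :
  bimodule_morphism
    (bidual_ext bT : dual_bimodule (dual_bimodule X) -> dual_bimodule Z).
Proof.
have [_ Tl Tr] := hT.
split=> [|a Phi|Phi a]; first exact: bidual_ext_bounded.
  apply: dual_ext => z /=; congr (Phi _); apply: dual_ext => x /=.
  by rewrite [T _]Tl.
apply: dual_ext => z /=; congr (Phi _); apply: dual_ext => x /=.
by rewrite [T _]Tr.
Qed.

Lemma bidual_ext_module_morphism (X : bimodule A) (Y : rmodule Ae)
    (T : X -> dual_lmodule Y) (hT : module_morphism (T : env Ae X -> _))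
    (bT : bounded_linear T) :
  module_morphism
    (bidual_ext bT : env Ae (dual_bimodule (dual_bimodule X)) -> dual_lmodule Y).
Proof.
have [_ Tb] := hT.
apply: module_morphismP => [|a Phi|a Phi|Phi].
- exact: bidual_ext_bounded.
- rewrite env_ltens; apply: dual_ext => y /=; congr (Phi _).
  by apply: dual_ext => x /=; rewrite -(@env_ltens _ _ Ae) Tb.
- rewrite env_rtens; apply: dual_ext => y /=; congr (Phi _).
  by apply: dual_ext => x /=; rewrite -(@env_rtens _ _ Ae) Tb.
rewrite env_one; apply: dual_ext => y /=; congr (Phi _).
by apply: dual_ext => x /=; rewrite -{1}(@env_one _ _ Ae _ x) Tb.
Qed.

Lemma ext_coboundary_trivial_dual n (Y : rmodule Ae)
    (f : P n.+1 -> dual_lmodule Y) :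
  (forall X : bimodule A, hochschild_trivial_topology (dual_bimodule X) n.+1) ->
  ext_cocycle f -> ext_coboundary f.
Proof.
move=> triv hf; have h2 : 0 <= 2^-1 :> C by rewrite invr_ge0.
have [rho hrho rho2|h hh hd] :=
    syzygy_extension (@dual_eval_morphism (syz n)) (triv _).
  have [brho _ _] := hrho; exists (bidual_ext brho); split=> [|x|k].
  - exact: bidual_ext_morphism.
  - exact: bidual_ext_norm.
  exact: bidual_extK.
have hf' := ext_cocycle_factor hf.
apply: (ext_coboundary_of_extension hh hd hf
  (bidual_ext_module_morphism hf' hf'.1)).
exact: bidual_extK.
Qed.

End SyzygyExtension.

Theorem corollary4p2 (R : realType) (A : banachAlgebra R)
    (Ae : enveloping_algebra A) (n : nat) :
  ((forall X : bimodule A, hochschild_trivial_topology X n.+1) ->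
     (db Ae <= n%:R%:E)%E) /\
  ((forall X : bimodule A, hochschild_trivial_topology (dual_bimodule X) n.+1) ->
     (w_db Ae <= n%:R%:E)%E).
Proof.
(* It is enough that n belongs to the set whose infimum is the dimension. *)
split=> triv; apply: ereal_inf_lbound; exists n => //= Y P f hf;
  have [sX [s [sX_bl s_bl aug_sX split0 splitS]]] := res_split P.
  exact: ext_coboundary_trivial sX_bl s_bl aug_sX split0 splitS _ _ _ triv hf.
exact: ext_coboundary_trivial_dual sX_bl s_bl aug_sX split0 splitS _ _ _ triv hf.
Qed.
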